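(* Suppose $\dagger(\mathsf{LP}_V)$ holds with respect to an inner model $V$ with $\omega_1^V = \omega_1$. Then there is a bowtie of functions, and consequently, there is a nontrivial automorphism of $\mathcal P(\omega)/\mathrm{Fin}$.
   Context: $V$ is an inner model of (a sufficiently large fragment of) $\mathsf{ZFC}$. For $h: \omega \to \omega\setminus\{0\}$, an $h$-slalom is a function $G$ with domain $\omega$ such that for every $n$, $G(n) \subseteq \omega^{n+1}$ and $|G(n)| \le h(n)$. $G$ captures $f \in \omega^\omega$ if $f\restriction(n+1) \in G(n)$ for every $n$. Let $\mathcal A = \{h \in \omega^\omega : h(n) \ne 0 \text{ for all } n, \text{ and } \lim_{n\to\infty} h(n) = \infty\}$. Let $\mathcal S = \{G \in \prod_{n\in\omega} \mathcal P(\omega^{n+1}) : G \text{ is an } h\text{-slalom for some } h \in \mathcal A\}$, and for $G \in \mathcal S$ let $\mathsf w_G:\omega\to\omega$ be $\mathsf w_G(n) = |G(n)|$. A real $r \in \omega^\omega$ is $V$-bounded if there is $b \in V \cap \omega^\omega$ with $r(n) \le b(n)$ for all $n$. $\dagger(\mathsf{LP}_V)$: for every sequence $\langle h_\alpha : \alpha<\omega_1\rangle$ of functions in $\mathcal A\cap V$ (the sequence itself need not be in $V$), there is a function $g:\omega_1\to\mathcal S\cap V$ such that $\mathsf w_{g(\alpha)} = h_\alpha$ for every $\alpha<\omega_1$ and $\{\alpha<\omega_1 : g(\alpha) \text{ captures } r\}$ is nonempty for every $V$-bounded $r \in \omega^\omega$. For $A,B \subseteq \omega$, $A =^* B$ means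 that the symmetric difference is finite, and $A \subseteq^* B$ means $A \setminus B$ is finite. For functions, $f =^* g$ means $\mathrm{dom}(f) =^* \mathrm{dom}(g) =^* \{x \in \mathrm{dom}(f)\cap \mathrm{dom}(g) : f(x) = g(x)\}$. Bowtie of functions: for each $\alpha<\omega_1$ let $D_\alpha \subseteq \omega$ and let $f_\alpha$ be a permutation $D_\alpha \to D_\alpha$ with no fixed points. The sequence $\langle f_\alpha : \alpha<\omega_1\rangle$ is a bowtie of functions if (i) $D_\alpha \subseteq^* D_\beta$ and $D_\beta \setminus D_\alpha$ is infinite whenever $\alpha<\beta<\omega_1$; (ii) $f_\alpha =^* f_\beta \restriction D_\alpha$ whenever $\alpha \le \beta<\omega_1$; (iii) for every $A \subseteq \omega$ there is some $\delta_A<\omega_1$ such that if $\delta_A \le \alpha<\omega_1$ then $f_\alpha[(D_\alpha \setminus D_{\delta_A}) \cap A] =^* (D_\alpha\setminus D_{\delta_A}) \cap A$ and $f_\alpha[(D_\alpha\setminus D_{\delta_A})\setminus A] =^* (D_\alpha\setminus D_{\delta_A})\setminus A$. $\mathcal P(\omega)/\mathrm{Fin}$ is the quotient of $\mathcal P(\omega)$ by the ideal of finite sets, with $[A]_{\mathrm{Fin}}$ the class of $A$. An automorphism of it is trivial if it has the form $[A]_{\mathrm{Fin}}\mapsto[f[A]]_{\mathrm{Fin}}$ for some bijection $f$ between cofinite subsets of $\omega$. *)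

(* Defs.v *)
From HB Require Import structures.
From mathcomp Require Import all_boot finmap all_classical.

Set Implicit Arguments.
Unset Strict Implicit.
Unset Printing Implicit Defensive.

Local Open Scope classical_set_scope.
Local Open Scope quotient_scope.
Local Open Scope card_scope.

(** * The universe of sets

    The cumulative hierarchy, as well-founded trees modulo bisimulation.  With
    classical logic and choice this is a model of ZFC; the inner model is a
    transitive class in it.  As every family of sets indexed by a (small) type
    is collected into a set by [zfamily], the power set of omega, the reals and
    omega_1 of this universe are the true ones.

    Classes have type [zset -> Prop], not [set zset], and families are not
    indexed by ordinal or tuple types: [set zset] puts the universe of [tree]
    below [predArgType], such families put it above; the two are inconsistent. *)

Inductive tree : Type := Node (A : Type) (F : A -> tree).

Fixpoint bisim (s t : tree) : Prop :=
  match s, t with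
  | Node A F, Node B G => (forall a, exists b, bisim (F a) (G b)) /\
                          (forall b, exists a, bisim (F a) (G b))
  end.

Lemma bisim_refl t : bisim t t.
Proof. by elim: t => A F IH; split=> a; exists a. Qed.

Lemma bisim_sym s t : bisim s t -> bisim t s.
Proof.
elim: s t => A F IH [B G] [FG GF]; split=> [b|a].
  by have [a /IH ?] := GF b; exists a.
by have [b /IH ?] := FG a; exists b.
Qed.

Lemma bisim_trans s t u : bisim s t -> bisim t u -> bisim s u.
Proof.
elim: s t u => A F IH [B G] [C H] [FG GF] [GH HG]; split=> [a|c].
  by have [b /IH ab] := FG a; have [c /ab ?] := GH b; exists c.
by have [b bc] := HG c; have [a /IH ab] := GF b; exists a; exact: ab bc.
Qed.

Lemma bisimE s t : bisim s t -> bisim s = bisim t.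
Proof.
move=> st; apply/funext => u; apply/propext; split; last exact: bisim_trans.
exact/bisim_trans/bisim_sym.
Qed.

Definition zset : Type := {P : tree -> Prop | exists t, P = bisim t}.

Definition zset_of (t : tree) : zset := exist _ (bisim t) (ex_intro _ t erefl).

Definition tree_of (x : zset) : tree := sval (cid (proj2_sig x)).

Definition zmem (x y : zset) : Prop :=
  match tree_of y with Node A F => exists a, x = zset_of (F a) end.

Definition univ : zset -> Prop := fun=> True.

Notation "x \eps y" := (zmem x y) (at level 70, no associativity).

(* The set { F a | a : A }. *)
Definition zfamily (A : Type) (F : A -> zset) : zset :=
  zset_of (Node (fun a => tree_of (F a))).

Lemma zset_inj (x y : zset) : sval x = sval y -> x = y.
Proof.
by case: x y => [P p] [Q q] /= E; subst Q; congr exist; exact: Prop_irrelevance.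
Qed.

Lemma tree_ofK : cancel tree_of zset_of.
Proof.
by move=> x; apply: zset_inj; rewrite /tree_of; case: (cid _).
Qed.

Lemma zset_of_eq s t : zset_of s = zset_of t <-> bisim s t.
Proof.
split=> [[E]|/bisimE E]; last exact: zset_inj.
by rewrite E; exact: bisim_refl.
Qed.

Lemma mem_zset_of x A (F : A -> tree) :
  x \eps zset_of (Node F) <-> exists a, x = zset_of (F a).
Proof.
rewrite /zmem; case E : (tree_of _) => [B G].
have /zset_of_eq [GF FG] : zset_of (Node G) = zset_of (Node F).
  by rewrite -E tree_ofK.
split=> -[i ->]; [have [j ?] := GF i | have [j /bisim_sym ?] := FG i];
  by exists j; apply/zset_of_eq.
Qed.

Lemma mem_zfamily x A (F : A -> zset) : x \eps zfamily F <-> exists a, x = F a.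
Proof.
rewrite mem_zset_of.
by split=> -[a ->]; exists a; rewrite tree_ofK.
Qed.

Lemma zset_ext x y : (forall z, z \eps x <-> z \eps y) -> x = y.
Proof.
rewrite -(tree_ofK x) -(tree_ofK y); move: (tree_of x) (tree_of y).
move=> [A F] [B G] E; apply/zset_of_eq; split=> [a|b].
  have /E/mem_zset_of [b /zset_of_eq ?] : zset_of (F a) \eps zset_of (Node F).
    by apply/mem_zset_of; exists a.
  by exists b.
have /E/mem_zset_of [a /zset_of_eq ?] : zset_of (G b) \eps zset_of (Node G).
  by apply/mem_zset_of; exists b.
by exists a; apply: bisim_sym.
Qed.

Lemma zset_ind_mem (P : zset -> Prop) :
  (forall x, (forall y, y \eps x -> P y) -> P x) -> forall x, P x.
Proof.
move=> IP x; rewrite -(tree_ofK x); elim: (tree_of x) => A F IH.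
by apply: IP => y /mem_zset_of [a ->].
Qed.

Definition trans_zset (x : zset) : Prop :=
  forall y z, z \eps y -> y \eps x -> z \eps x.

(* Von Neumann ordinals; foundation makes this definition correct. *)
Definition ordinal (x : zset) : Prop :=
  trans_zset x /\ forall y, y \eps x -> trans_zset y.

Definition zsucc (x : zset) : zset :=
  let: Node A F := tree_of x in
  zfamily (fun o : option A => if o is Some a then zset_of (F a) else x).

Definition numeral (n : nat) : zset :=
  iter n zsucc (zfamily (fun e : False => match e with end)).

Definition omega : zset := zfamily numeral.

Definition upair (x y : zset) : zset := zfamily (fun b : bool => if b then x else y).

Definition opair (x y : zset) : zset := upair (upair x x) (upair x y).

(* The function f, as a set of pairs, is an injection from a to b. *)
Definition injection (f a b : zset) : Prop :=
  [/\ forall p, p \eps f -> exists x y, [/\ x \eps a, y \eps b & p = opair x y],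
      forall x, x \eps a -> exists! y, opair x y \eps f &
      forall x x' y, opair x y \eps f -> opair x' y \eps f -> x = x'].

(** * Inner models *)

(* Formulas of set theory with de Bruijn indices. *)
Inductive formula : Type :=
| Fmem (i j : nat)
| Feq (i j : nat)
| Fbot
| Fimp (p q : formula)
| Fall (p : formula).

Definition scons (x : zset) (e : nat -> zset) (n : nat) : zset :=
  if n is k.+1 then e k else x.

(* Satisfaction relativized to the class M. *)
Fixpoint sat (M : zset -> Prop) (p : formula) (e : nat -> zset) : Prop :=
  match p with
  | Fmem i j => e i \eps e j
  | Feq i j => e i = e j
  | Fbot => False
  | Fimp p q => sat M p e -> sat M q e
  | Fall p => forall x, M x -> sat M p (scons x e)
  end.

(* The ZFC axioms relativized to M, with the two schemas restricted to the
   formulas in Phi: all of ZFC is [ZFC_in setT], and every finite fragment of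
   ZFC is contained in [ZFC_in Phi] for some finite Phi. *)
Record ZFC_in (Phi : set formula) (M : zset -> Prop) : Prop := {
  ax_extensionality : forall x y, M x -> M y ->
    (forall z, M z -> (z \eps x <-> z \eps y)) -> x = y;
  ax_foundation : forall x, M x -> (exists2 y, M y & y \eps x) ->
    exists y, [/\ M y, y \eps x & ~ exists z, [/\ M z, z \eps x & z \eps y]];
  ax_pairing : forall x y, M x -> M y -> exists2 z, M z &
    forall w, M w -> (w \eps z <-> w = x \/ w = y);
  ax_union : forall x, M x -> exists2 u, M u &
    forall w, M w -> (w \eps u <-> exists y, [/\ M y, y \eps x & w \eps y]);
  ax_power : forall x, M x -> exists2 p, M p &
    forall w, M w -> (w \eps p <-> forall z, M z -> z \eps w -> z \eps x);
  ax_infinity : exists w, [/\ M w,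
    exists z, [/\ M z, z \eps w & forall y, M y -> ~ y \eps z] &
    forall x, M x -> x \eps w -> exists s, [/\ M s, s \eps w &
      forall z, M z -> (z \eps s <-> z \eps x \/ z = x)]];
  ax_separation : forall p e a, Phi p -> (forall i, M (e i)) -> M a ->
    exists2 b, M b &
      forall x, M x -> (x \eps b <-> x \eps a /\ sat M p (scons x e));
  ax_replacement : forall p e a, Phi p -> (forall i, M (e i)) -> M a ->
    (forall x, M x -> x \eps a ->
      exists! y, M y /\ sat M p (scons y (scons x e))) ->
    exists2 b, M b & forall y, M y ->
      (y \eps b <->
       exists x, [/\ M x, x \eps a & sat M p (scons y (scons x e))]);
  ax_choice : forall F, M F ->
    (forall x, M x -> x \eps F -> exists2 y, M y & y \eps x) ->
    (forall x x' y, M x -> M x' -> M y -> x \eps F -> x' \eps F ->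
       y \eps x -> y \eps x' -> x = x') ->
    exists2 c, M c & forall x, M x -> x \eps F ->
      exists! y, [/\ M y, y \eps c & y \eps x]
}.

Record inner_model (Phi : set formula) (M : zset -> Prop) : Prop := {
  inner_trans : forall x y, y \eps x -> M x -> M y;
  inner_ord : forall x, ordinal x -> M x;
  inner_ZFC : ZFC_in Phi M
}.

(* k is the first uncountable ordinal in the sense of M: being an ordinal and
   being an injection are absolute for transitive classes. *)
Definition is_omega1 (M : zset -> Prop) (k : zset) : Prop :=
  [/\ M k, ordinal k,
      ~ exists2 f, M f & injection f k omega &
      forall a, a \eps k -> exists2 f, M f & injection f a omega].

Definition elts (k : zset) : Type := {a : zset | a \eps k}.

Definition lt_elts (k : zset) (a b : elts k) : Prop := sval a \eps sval b.

Definition le_elts (k : zset) (a b : elts k) : Prop := a = b \/ lt_elts a b.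

(** * Slaloms and the principle for inner models *)

Definition slalom : Type := forall n, set (n.+1.-tuple nat).

Definition is_slalom (h : nat -> nat) (G : slalom) : Prop :=
  forall n, G n #<= `I_(h n).

Definition captures (G : slalom) (f : nat -> nat) : Prop :=
  forall n, G n [tuple f i | i < n.+1].

Definition calA : set (nat -> nat) :=
  [set h | (forall n, h n != 0) /\ h @ \oo --> \oo].

Definition calS : set slalom := [set G | exists2 h, calA h & is_slalom h G].

(* Meaningful on calS, whose members have finite values. *)
Definition width (G : slalom) (n : nat) : nat := #|` fset_set (G n)|.

Definition zset_of_real (f : nat -> nat) : zset :=
  zfamily (fun n => opair (numeral n) (numeral (f n))).

Definition zset_of_seq (s : seq nat) : zset :=
  zfamily (fun i : {i | i < size s} =>
    opair (numeral (sval i)) (numeral (nth 0 s (sval i)))).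

Definition zset_of_slalom (G : slalom) : zset :=
  zfamily (fun n => opair (numeral n)
    (zfamily (fun s : {s : seq nat | exists2 t, G n t & s = tval t} =>
       zset_of_seq (sval s)))).

Definition bounded_by (V : zset -> Prop) (r : nat -> nat) : Prop :=
  exists2 b, V (zset_of_real b) & forall n, r n <= b n.

Definition dagger_LP (V : zset -> Prop) (w1 : zset) : Prop :=
  forall h : elts w1 -> nat -> nat,
    (forall a, calA (h a) /\ V (zset_of_real (h a))) ->
    exists g : elts w1 -> slalom,
      [/\ forall a, calS (g a) /\ V (zset_of_slalom (g a)),
          forall a, width (g a) = h a &
          forall r, bounded_by V r -> exists a, captures (g a) r].

(** * Bowties of functions *)

Definition eqfin (A B : set nat) : Prop := finite_set (A `+` B).

Definition subfin (A B : set nat) : Prop := finite_set (A `\` B).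

Notation "A =* B" := (eqfin A B) (at level 70, no associativity).
Notation "A `<=*` B" := (subfin A B) (at level 70, no associativity).

(* Partial functions on omega; the values off the domain are irrelevant. *)
Record pfun : Type := PFun { pdom : set nat; papp : nat -> nat }.

Definition pimage (f : pfun) (A : set nat) : set nat := papp f @` (pdom f `&` A).

Definition prestrict (f : pfun) (A : set nat) : pfun :=
  PFun (pdom f `&` A) (papp f).

Definition peqfin (f g : pfun) : Prop :=
  pdom f =* pdom g /\
  pdom g =* [set x | (pdom f `&` pdom g) x /\ papp f x = papp g x].

Definition bowtie (w1 : zset) (f : elts w1 -> pfun) : Prop :=
  [/\ forall a, set_bij (pdom (f a)) (pdom (f a)) (papp (f a)) /\
                forall x, pdom (f a) x -> papp (f a) x <> x,
      forall a b, lt_elts a b -> pdom (f a) `<=*` pdom (f b) /\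
                                 infinite_set (pdom (f b) `\` pdom (f a)),
      forall a b, le_elts a b -> peqfin (f a) (prestrict (f b) (pdom (f a))) &
      forall A : set nat, exists d, forall a, le_elts d a ->
        let E := pdom (f a) `\` pdom (f d) in
        pimage (f a) (E `&` A) =* (E `&` A) /\
        pimage (f a) (E `\` A) =* (E `\` A)].

(** * The Boolean algebra of sets of naturals modulo finite *)

Lemma eqfin_refl A : A =* A.
Proof. by rewrite /eqfin setYK; exact: finite_set0. Qed.

Lemma eqfin_sym A B : A =* B -> B =* A.
Proof. by rewrite /eqfin setYC. Qed.

Lemma eqfin_trans A B C : A =* B -> B =* C -> A =* C.
Proof.
move=> AB BC; have : finite_set ((A `+` B) `|` (B `+` C)) by rewrite finite_setU.
apply: sub_finite_set => x; rewrite !setY_def /=.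
by have [Bx|nBx] := pselect (B x); tauto.
Qed.

Definition eqfinb : rel (set nat) := fun A B => `[< A =* B >].

Lemma eqfinb_equiv : equiv_class_of eqfinb.
Proof.
split=> [A|A B|B A C]; first exact/asboolP/eqfin_refl.
  by apply/asboolP/asboolP; exact: eqfin_sym.
by move=> /asboolP AB /asboolP BC; apply/asboolP; exact: eqfin_trans AB BC.
Qed.

Canonical eqfinb_equivRel := EquivRelPack eqfinb_equiv.

Definition PFin : Type := {eq_quot eqfinb}.

Definition cls (A : set nat) : PFin := \pi_{eq_quot eqfinb} A.

Definition rpr (x : PFin) : set nat := repr (x : {eq_quot eqfinb}).

Lemma clsP A B : cls A = cls B <-> A =* B.
Proof. by split=> [/eqmodP/asboolP|AB]; last exact/eqmodP/asboolP. Qed.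

Lemma rprK : cancel rpr cls.
Proof. by move=> x; exact: reprK. Qed.

Definition joinFin (x y : PFin) : PFin := cls (rpr x `|` rpr y).
Definition meetFin (x y : PFin) : PFin := cls (rpr x `&` rpr y).
Definition complFin (x : PFin) : PFin := cls (~` rpr x).

Lemma joinFinE A B : joinFin (cls A) (cls B) = cls (A `|` B).
Proof.
have /clsP a := rprK (cls A); have /clsP b := rprK (cls B); apply/clsP.
have : finite_set ((rpr (cls A) `+` A) `|` (rpr (cls B) `+` B)).
  by rewrite finite_setU.
by apply: sub_finite_set => x; rewrite !setY_def /=; tauto.
Qed.

Lemma complFinE A : complFin (cls A) = cls (~` A).
Proof.
have /clsP a := rprK (cls A); apply/clsP; apply: sub_finite_set a => x.
rewrite !setY_def /= => -[[nx Ax]|[nAx nx]]; [right|left]; split=> //.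
  by apply: contrapT.
by apply: contrapT.
Qed.

Lemma meetFinE A B : meetFin (cls A) (cls B) = cls (A `&` B).
Proof.
have /clsP a := rprK (cls A); have /clsP b := rprK (cls B); apply/clsP.
have : finite_set ((rpr (cls A) `+` A) `|` (rpr (cls B) `+` B)).
  by rewrite finite_setU.
apply: sub_finite_set => x; rewrite !setY_def /=.
by have [|] := pselect (A x); have [|] := pselect (B x);
  have [|] := pselect (rpr (cls A) x); have [|] := pselect (rpr (cls B) x); tauto.
Qed.

Definition automorphism (phi : PFin -> PFin) : Prop :=
  [/\ bijective phi,
      forall x y, phi (joinFin x y) = joinFin (phi x) (phi y),
      forall x y, phi (meetFin x y) = meetFin (phi x) (phi y) &
      forall x, phi (complFin x) = complFin (phi x)].

Definition trivial_automorphism (phi : PFin -> PFin) : Prop :=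
  exists (f : pfun) (C : set nat),
    [/\ finite_set (~` pdom f), finite_set (~` C), set_bij (pdom f) C (papp f) &
        forall A, phi (cls A) = cls (pimage f A)].

(* Main.v *)
Require Import Defs.
From mathcomp Require Import all_boot all_classical.
From mathcomp Require Import zify.

Set Implicit Arguments.
Unset Strict Implicit.
Unset Printing Implicit Defensive.

Local Open Scope classical_set_scope.

(** Cut omega into finite blocks, the k-th one having block_size k points, the
    point i of block k being coded by pickle (k, i).  A stage of the
    construction consists, in each block, of an involution with finite support
    and of a reserve: a set of fixed points to which all later changes are
    confined.  The bowtie is the sequence of the involutions, each restricted
    to the points that it moves.

    Apply the principle to the constant sequence of value n |-> n + 1.  It
    assigns to each stage a slalom that offers, in block k, at most k + 1
    candidates for the trace of a set A on the block, a trace being coded by a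
    number below 2 ^ block_size k.  Splitting the reserve k + 1 times in two
    leaves a part of it on which every candidate is constant
    (homogeneous_subset).  The stage swaps two points of that part and keeps the
    other ones as its reserve (step_exists).  If A is among the candidates in
    every block, all the later involutions then move the new points within A or
    within its complement, which is the third clause of a bowtie; and every A is
    captured by the slalom of some stage, because its codes are bounded by a
    function of V.

    The size of the reserve is measured on a logarithmic scale of base
    2 ^ (k + 3) in block k, so that a step costs one unit.  The measure tends to
    infinity with k at every stage.  As each stage has only countably many
    predecessors, these can be patched together: each block is taken from a
    predecessor that depends on the block and grows slowly enough for the
    measure to go to infinity still (countable_chain_bound).  So the
    construction reaches omega_1 (tower_exists, state_tower, bowtie_exists).

    The bound of the codes is a function b in V with 2 ^ block_size k <= b k.  It
    is obtained from the successor function by iterating three times, inside V,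
    the passage from f to n |-> (f o f)^n (4).  The formulas in Phi define the
    successor function and this passage (V_succ, V_iter, V_fast).

    Given a bowtie, let hat a be the permutation of omega that extends f a by
    the identity.  For each A the preimages of A under hat a agree modulo finite
    for all large a (hat_stable), so their common class defines an automorphism
    phi (eventual_pullback, pullback_automorphism).  If phi were induced by an
    injection g, then g would invert hat a almost everywhere on the domain of
    f a, for every a (trivial_inverts_hat).  Color omega with three colors so
    that g x and x have different colors when they differ.  For large a, f a
    preserves each color almost everywhere on an infinite set, and g both
    inverts f a there and changes the color: a contradiction
    (pullback_nontrivial). *)

Arguments numeral : simpl never.

(** * Pairs and numerals *)

Lemma mem_upair z x y : z \eps upair x y <-> z = x \/ z = y.
Proof.
rewrite mem_zfamily; split=> [[[]->]|[->|->]]; [by left|by right| |].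
  by exists true.
by exists false.
Qed.

Lemma upair_inj x y y' : upair x y = upair x y' -> y = y'.
Proof.
move=> E.
have : y \eps upair x y' by rewrite -E mem_upair; right.
have : y' \eps upair x y by rewrite E mem_upair; right.
by rewrite !mem_upair => -[->|->] // [].
Qed.

Lemma upair1_inj x y y' : upair x x = upair y y' -> x = y.
Proof.
by move=> E; have : y \eps upair x x by [rewrite E mem_upair; left];
  rewrite mem_upair => -[].
Qed.

Lemma opair_inj x y x' y' : opair x y = opair x' y' -> x = x' /\ y = y'.
Proof.
move=> E.
have Exx : x = x'.
  have : upair x x \eps opair x' y' by rewrite -E mem_upair; left.
  by rewrite mem_upair => -[] /upair1_inj.
by split=> //; subst x'; exact/upair_inj/upair_inj/E.
Qed.

Lemma mem_zsucc z x : z \eps zsucc x <-> z \eps x \/ z = x.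
Proof.
have Ex := tree_ofK x; rewrite /zsucc; case: (tree_of x) Ex => A F Ex.
rewrite mem_zfamily; have -> : z \eps x <-> exists a, z = zset_of (F a).
  by rewrite -Ex mem_zset_of.
split=> [[[a|] ->]|[[a ->]|->]].
- by left; exists a.
- by right.
- by exists (Some a).
- by exists None.
Qed.

Lemma mem_numeral z n : z \eps numeral n <-> exists2 m, m < n & z = numeral m.
Proof.
elim: n z => [|n IH] z; first by rewrite mem_zfamily; split=> [[[]]|[]].
rewrite [numeral n.+1]/(zsucc (numeral n)) mem_zsucc IH.
split=> [[[m mn ->]| ->]|[m]].
- by exists m => //; exact: ltnW.
- by exists n.
rewrite ltnS leq_eqVlt => /orP[/eqP-> ->|mn ->]; [by right|by left; exists m].
Qed.

Lemma zmem_irrefl x : ~ x \eps x.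
Proof. by elim/zset_ind_mem: x => x IH xx; exact: (IH x xx xx). Qed.

Lemma numeral_inj : injective numeral.
Proof.
move=> m n E; case: (ltngtP m n) => // mn; exfalso.
  apply: (@zmem_irrefl (numeral m)); rewrite {2}E mem_numeral.
  by exists m.
apply: (@zmem_irrefl (numeral n)); rewrite -{2}E mem_numeral.
by exists n.
Qed.

Lemma mem_omega z : z \eps omega <-> exists n, z = numeral n.
Proof. exact: mem_zfamily. Qed.

Lemma omega_ordinal : Defs.ordinal omega.
Proof.
split=> [y z zy /mem_omega[n yn]|y /mem_omega[n ->] u v].
  by move: zy; rewrite yn => /mem_numeral[m _ ->]; apply/mem_omega; exists m.
move=> vu /mem_numeral[m mn um]; move: vu; rewrite um => /mem_numeral[k km ->].
by apply/mem_numeral; exists k => //; exact: ltn_trans km mn.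
Qed.

Lemma mem_zset_of_real f x y : opair x y \eps zset_of_real f <->
  exists n, x = numeral n /\ y = numeral (f n).
Proof.
by rewrite mem_zfamily; split=> -[n]; [move=> /opair_inj; exists n
  |move=> [-> ->]; exists n].
Qed.

(** * Formulas for pairs, successors and iteration *)

Definition Fnot p := Fimp p Fbot.
Definition For p q := Fimp (Fnot p) q.
Definition Fand p q := Fnot (Fimp p (Fnot q)).
Definition Fiff p q := Fand (Fimp p q) (Fimp q p).
Definition Fex p := Fnot (Fall (Fnot p)).

Definition Fupair x y z := Fall (Fiff (Fmem 0 x.+1) (For (Feq 0 y.+1) (Feq 0 z.+1))).
Definition Fopair x y z :=
  Fex (Fex (Fand (Fupair 1 y.+2 y.+2)
           (Fand (Fupair 0 y.+2 z.+2) (Fupair x.+2 1 0)))).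
Definition Fopair_in y z a := Fex (Fand (Fmem 0 a.+1) (Fopair 0 y.+1 z.+1)).
Definition Fsucc x y := Fall (Fiff (Fmem 0 x.+1) (For (Fmem 0 y.+1) (Feq 0 y.+1))).

(** Variable 0 is the pair under test, and there are no parameters. *)
Definition succ_graph_formula := Fex (Fex (Fand (Fopair 2 1 0) (Fsucc 0 1))).

(** Variable 0 is the pair p under test; the parameters 1, 2 and 3 are the graph
    of the successor function, the graph of a function f and the pair
    (0, initial value).  The formula says that p belongs to a set s each of
    whose elements is either the initial pair or of the form (i + 1, f (f j))
    for some (i, j) in s.  Under the five inner existential quantifiers the
    variables 4 3 2 1 0 are i, i + 1, j, f j, f (f j), while 5 and 6 are the
    earlier and the later pair.  Applying f twice is what turns the successor
    function into one that grows at least as fast as doubling. *)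
Definition iter_graph_formula :=
  Fex (Fand (Fmem 1 0)
  (Fall (Fimp (Fmem 0 1)
  (For (Feq 0 5)
  (Fex (Fand (Fmem 0 2)
  (Fex (Fex (Fex (Fex (Fex
     (Fand (Fopair 5 4 2)
     (Fand (Fopair 6 3 0)
     (Fand (Fopair_in 4 3 9)
     (Fand (Fopair_in 2 1 10) (Fopair_in 1 0 10)))))))))))))))).

Section Satisfaction.
Variable V : zset -> Prop.
Implicit Types (p q : formula) (e : nat -> zset).

Lemma sat_imp p q e : sat V (Fimp p q) e <-> (sat V p e -> sat V q e).
Proof. by []. Qed.

Lemma sat_or p q e : sat V (For p q) e <-> sat V p e \/ sat V q e.
Proof.
by rewrite /For /=; have [|] := pselect (sat V p e); tauto.
Qed.

Lemma sat_and p q e : sat V (Fand p q) e <-> sat V p e /\ sat V q e.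
Proof.
by rewrite /Fand /=; have [|] := pselect (sat V p e);
  have [|] := pselect (sat V q e); tauto.
Qed.

Lemma sat_iff p q e : sat V (Fiff p q) e <-> (sat V p e <-> sat V q e).
Proof. exact: sat_and. Qed.

Lemma sat_all p e :
  sat V (Fall p) e <-> forall x, V x -> sat V p (scons x e).
Proof. by []. Qed.

Lemma sat_ex p e : sat V (Fex p) e <-> exists2 x, V x & sat V p (scons x e).
Proof.
split=> [nall|[x Vx px] nall]; last exact: nall px.
apply: contrapT => nex; apply: nall => x Vx px.
by apply: nex; exists x.
Qed.

End Satisfaction.

Section ClosureOfInnerModels.
Variables (Phi : set formula) (V : zset -> Prop).
Hypothesis VM : inner_model Phi V.
Let Vtr := inner_trans VM.

Lemma V_numeral n : V (numeral n).
Proof.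
apply: Vtr (inner_ord VM omega_ordinal).
by apply/mem_omega; exists n.
Qed.

Lemma V_upair x y : V x -> V y -> V (upair x y).
Proof.
move=> Vx Vy; have [z Vz zP] := ax_pairing (inner_ZFC VM) Vx Vy.
rewrite (_ : upair x y = z) //; apply: zset_ext => w; rewrite mem_upair.
split=> [xy|wz]; last by apply/zP => //; exact: Vtr wz Vz.
by apply/zP => //; case: xy => ->.
Qed.

Lemma V_opair x y : V x -> V y -> V (opair x y).
Proof. by move=> Vx Vy; apply: V_upair; exact: V_upair. Qed.

Lemma V_opair_inv x y : V (opair x y) -> V x /\ V y.
Proof.
move=> Vp; have Vu : V (upair x y) by apply: Vtr Vp; apply/mem_upair; right.
by split; apply: Vtr Vu; apply/mem_upair; [left|right].
Qed.

Lemma V_adjoin x y : V x -> V y ->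
  exists2 z, V z & forall w, w \eps z <-> w \eps x \/ w = y.
Proof.
move=> Vx Vy; have Vxy := V_upair Vx (V_upair Vy Vy).
have [u Vu uP] := ax_union (inner_ZFC VM) Vxy; exists u => // w.
have Vmem v : v \eps x -> V v by move/Vtr; exact.
split=> [wu|wxy].
  have /uP[//|v [_ vxy wv]] := wu; first exact: Vtr wu Vu.
  move: vxy wv; rewrite mem_upair => -[->|->]; first by left.
  by rewrite mem_upair => -[]; right.
have Vw : V w by case: wxy => [/Vmem|->].
apply/uP => //; case: wxy => [wx| ->].
  by exists x; split=> //; apply/mem_upair; left.
by exists (upair y y); split; [exact: V_upair|apply/mem_upair; right
  |apply/mem_upair; left].
Qed.

Lemma sat_upair x y z e : V (e x) -> V (e y) -> V (e z) ->
  sat V (Fupair x y z) e <-> e x = upair (e y) (e z).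
Proof.
move=> Vx Vy Vz; rewrite sat_all; split=> [S|E w Vw].
  apply: zset_ext => w; rewrite mem_upair; split=> [wx|wyz].
    by have /sat_iff[S1 _] := S w (Vtr wx Vx); have /sat_or := S1 wx.
  have Vw : V w by case: wyz => ->.
  by have /sat_iff[_ S2] := S w Vw; apply: S2; exact/sat_or.
by apply/sat_iff; rewrite sat_or /= E mem_upair.
Qed.

Lemma sat_opair x y z e : V (e x) -> V (e y) -> V (e z) ->
  sat V (Fopair x y z) e <-> e x = opair (e y) (e z).
Proof.
move=> Vx Vy Vz; rewrite sat_ex; split=> [[u Vu /sat_ex[v Vv]]|E].
  move=> /sat_and[/sat_upair Eu /sat_and[/sat_upair Ev /sat_upair Ex]].
  by rewrite /opair -Eu // -Ev // -Ex.
exists (upair (e y) (e y)); first exact: V_upair.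
apply/sat_ex; exists (upair (e y) (e z)); first exact: V_upair.
by apply/sat_and; split; [|apply/sat_and; split]; apply/sat_upair => //=;
  exact: V_upair.
Qed.

Lemma sat_opair_in y z a e : V (e a) -> V (e y) -> V (e z) ->
  sat V (Fopair_in y z a) e <-> opair (e y) (e z) \eps e a.
Proof.
move=> Va Vy Vz; rewrite sat_ex; split=> [[u Vu /sat_and[]]|ya].
  by move=> ua /sat_opair E; rewrite -E.
exists (opair (e y) (e z)); first exact: V_opair.
by apply/sat_and; split=> //; apply/sat_opair => //; exact: V_opair.
Qed.

Lemma sat_succ x y e : V (e x) -> V (e y) ->
  sat V (Fsucc x y) e <-> e x = zsucc (e y).
Proof.
move=> Vx Vy; rewrite sat_all; split=> [S|E w Vw].
  apply: zset_ext => w; rewrite mem_zsucc; split=> [wx|wy].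
    by have /sat_iff[S1 _] := S w (Vtr wx Vx); have /sat_or := S1 wx.
  have Vw : V w by case: wy => [/Vtr|->]; first exact.
  by have /sat_iff[_ S2] := S w Vw; apply: S2; exact/sat_or.
by apply/sat_iff; rewrite sat_or /= E mem_zsucc.
Qed.

(* Pairs of numerals all lie in the double power set of omega. *)
Lemma V_pairs : exists2 a, V a &
  (forall m n, opair (numeral m) (numeral n) \eps a) /\
  (forall x y, opair x y \eps a -> exists2 n, x = numeral n & V y).
Proof.
have Vw := inner_ord VM omega_ordinal.
have [p Vp pP] := ax_power (inner_ZFC VM) Vw.
have [a Va aP] := ax_power (inner_ZFC VM) Vp.
have Vn := V_numeral.
have sub m n : upair (numeral m) (numeral n) \eps p.
  apply/pP; first exact: V_upair.
  by move=> z _ /mem_upair[]->; apply/mem_omega; [exists m|exists n].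
exists a => //; split=> [m n|x y xya].
  apply/aP; first exact: V_opair.
  by move=> z _ /mem_upair[]->.
have Vxy := Vtr xya Va; have [Vx Vy] := V_opair_inv Vxy.
have /aP := xya => /(_ Vxy (upair x x) (V_upair Vx Vx)).
rewrite mem_upair => /(_ (or_introl erefl)) /pP.
move=> /(_ (V_upair Vx Vx) x Vx); rewrite mem_upair => /(_ (or_introl erefl)).
by move=> /mem_omega[n ->]; exists n.
Qed.

(** Separation from the double power set of omega: the formula has only to tell
    which pairs with a numeral on the left it accepts. *)
Lemma V_real_of_formula p e f : Phi p -> (forall i, V (e i)) ->
  (forall x, V x -> sat V p (scons x e) -> exists y z, x = opair y z) ->
  (forall n y, V y ->
     sat V p (scons (opair (numeral n) y) e) <-> y = numeral (f n)) ->
  V (zset_of_real f).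
Proof.
move=> Pp Ve pairs pf; have [a Va [aI aE]] := V_pairs.
have [b Vb bP] := ax_separation (inner_ZFC VM) Pp Ve Va.
rewrite (_ : zset_of_real f = b) //; apply: zset_ext => x.
have Vn := V_numeral; split=> [/mem_zfamily[n ->]|xb].
  by apply/bP; [exact: V_opair|split=> //; exact/pf].
have Vx := Vtr xb Vb; have /(bP _ Vx)[xa px] := xb.
have [y [z E]] := pairs x Vx px; rewrite E in xa px *.
have [n En Vz] := aE _ _ xa; rewrite En in px *.
by apply/mem_zset_of_real; exists n; split=> //; exact/pf.
Qed.

Lemma V_succ : Phi succ_graph_formula -> V (zset_of_real succn).
Proof.
move=> /V_real_of_formula; apply=> [i|x Vx|n y Vy]; first exact: V_numeral 0.
  move=> /sat_ex[y Vy /sat_ex[z Vz /sat_and[/sat_opair E _]]].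
  by exists y, z; exact: E.
have Vn := V_numeral; rewrite sat_ex; split=> [[u Vu /sat_ex[v Vv /sat_and[]]]|->].
  move=> /sat_opair E /sat_succ S; have /opair_inj[/= E1 E2] := E (V_opair (Vn n) Vy) Vu Vv.
  by rewrite E2; rewrite /= in S; rewrite S // -E1.
exists (numeral n) => //; apply/sat_ex; exists (numeral n.+1) => //.
apply/sat_and; split; last (apply/sat_succ; [exact: Vn|exact: Vn|by []]).
by apply/sat_opair; [exact: V_opair|exact: Vn|exact: Vn|by []].
Qed.

Definition iter_env (f : nat -> nat) c i :=
  match i with
  | 0 => zset_of_real succn
  | 1 => zset_of_real f
  | _ => opair (numeral 0) (numeral c)
  end.

(** The formula needs only one witness s for each pair of the graph, so it is
    enough that V contains the finite initial segments of the graph.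
    Conversely any witness is contained in the graph, by induction on the first
    component of its elements. *)
Lemma V_iter f c : Phi succ_graph_formula -> Phi iter_graph_formula ->
  V (zset_of_real f) -> V (zset_of_real (fun n => iter n (f \o f) c)).
Proof.
move=> Ps Pi Vf; have VS := V_succ Ps; have Vn := V_numeral.
have Ve i : V (iter_env f c i) by move: i => [|[|i]] //=; exact: V_opair.
pose g n := iter n (f \o f) c.

have satE x : V x -> sat V iter_graph_formula (scons x (iter_env f c)) <->
  exists s, [/\ V s, x \eps s & forall q, q \eps s ->
    q = opair (numeral 0) (numeral c) \/
    exists m j, opair (numeral m) (numeral j) \eps s /\
       q = opair (numeral m.+1) (numeral (f (f j)))].
  move=> Vx; rewrite sat_ex; split=> [[s Vs /sat_and[xs /sat_all sP]]|].
    exists s; split=> // q qs; have Vq := Vtr qs Vs.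
    have /sat_imp/(_ qs)/sat_or[qE|/sat_ex[q' Vq' /sat_and[q's q'P]]] := sP q Vq; [by left|right].
    move: q'P => /sat_ex[i Vi /sat_ex[i' Vi' /sat_ex[j Vj /sat_ex[k Vk /sat_ex[j' Vj']]]]].
    move=> /sat_and[E1 /sat_and[E2 /sat_and[E3 /sat_and[E4 E5]]]].
    move/sat_opair: E1 => /= E1; move/sat_opair: E2 => /= E2.
    move/sat_opair_in: E3 => /= E3; move/sat_opair_in: E4 => /= E4.
    move/sat_opair_in: E5 => /= E5.
    move: E3 => /(_ VS Vi Vi') /mem_zset_of_real[m [Ei Ei']].
    move: E4 => /(_ Vf Vj Vk) /mem_zset_of_real[l [Ej Ek]].
    move: E5 => /(_ Vf Vk Vj') /mem_zset_of_real[l' [Ek' Ej']].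
    exists m, l; rewrite -Ei -Ej -E1 // E2 //; split=> //.
    by rewrite Ei' Ej'; move: Ek; rewrite Ek' => /numeral_inj ->.
  move=> [s [Vs xs sP]]; exists s => //; apply/sat_and; split=> //.
  apply/sat_all => q Vq; apply/sat_imp => qs; apply/sat_or; have [|[m [j [mjs qE]]]] := sP q qs.
    by left.
  right; apply/sat_ex; exists (opair (numeral m) (numeral j)).
    exact: V_opair.
  apply/sat_and; split=> //.
  apply/sat_ex; exists (numeral m) => //; apply/sat_ex; exists (numeral m.+1) => //.
  apply/sat_ex; exists (numeral j) => //; apply/sat_ex; exists (numeral (f j)) => //.
  apply/sat_ex; exists (numeral (f (f j))) => //.
  apply/sat_and; split; first by apply/sat_opair; do ?[exact: V_opair | exact: Vn].
  apply/sat_and; split; first by apply/sat_opair; do ?[exact: V_opair | exact: Vn].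
  apply/sat_and; split.
    by apply/sat_opair_in; do ?[exact: VS | exact: Vn];
      apply/mem_zset_of_real; exists m.
  by apply/sat_and; split; apply/sat_opair_in; do ?[exact: Vf | exact: Vn];
    apply/mem_zset_of_real; [exists j|exists (f j)].
apply: (V_real_of_formula Pi Ve) => [x Vx /(satE x Vx)[s [_ xs sP]]|n y Vy].
  have [->|[m [j [_ ->]]]] := sP x xs; first by exists (numeral 0), (numeral c).
  by exists (numeral m.+1), (numeral (f (f j))).
rewrite satE; last exact: V_opair.
split=> [[s [_ ys sP]]|->].
  elim: n y {Vy} ys => [|n IH] y ys; have [|[m [j [mjs]]]] := sP _ ys.
  - by move=> /opair_inj[].
  - by move=> /opair_inj[/numeral_inj].
  - by move=> /opair_inj[/numeral_inj].
  move=> /opair_inj[/numeral_inj[nm] ->] /=; move: mjs; rewrite -nm.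
  by move=> /IH /numeral_inj ->.
have [s [Vs sP]] : exists s, V s /\ forall q,
    q \eps s <-> exists2 m, m <= n & q = opair (numeral m) (numeral (g m)).
  elim: n {Vy} => [|n [s [Vs sP]]].
    exists (upair (opair (numeral 0) (numeral c)) (opair (numeral 0) (numeral c))).
    split=> [|q]; first by apply: V_upair; exact: V_opair.
    rewrite mem_upair; split=> [[]->|[m]]; try by exists 0.
    by rewrite leqn0 => /eqP-> ->; left.
  have Vp : V (opair (numeral n.+1) (numeral (g n.+1))) by exact: V_opair.
  have [t Vt tP] := V_adjoin Vs Vp; exists t; split=> // q; rewrite tP sP.
  split=> [[[m mn ->]| ->]|[m]]; first by exists m => //; exact: ltnW.
    by exists n.+1.
  rewrite leq_eqVlt => /orP[/eqP-> ->|mn ->]; [by right|by left; exists m].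
exists s; split=> //; first by apply/sP; exists n.
move=> q /sP[[|m] mn ->]; first by left.
by right; exists m, (g m); split=> //; apply/sP; exists m => //; exact: ltnW.
Qed.

End ClosureOfInnerModels.

(** * Fast functions *)

(** The exponent is k times k + 3, so the reserve of block k starts with measure
    k on the scale of base 2 ^ (k + 3), and the measure tends to infinity. *)
Definition block_size k := 2 ^ ((k + 3) * k).

Lemma iter_double_ge f k : (forall x, 2 * x <= f x) ->
  2 ^ k <= iter k f 4.
Proof.
move=> f2; elim: k => [|k IH] //.
by rewrite expnS iterS; apply: leq_trans (f2 _); rewrite leq_pmul2l.
Qed.

(** One application of f gains two exponentials, and those are just what is
    needed: it suffices that the previous value bounds the next exponent
    (k + 4) * (k + 1), which is only quadratic. *)
Lemma iter_tower_ge f k : (forall x, 2 ^ (2 ^ x) <= f x) ->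
  2 ^ block_size k <= iter k f 4.
Proof.
move=> ff; case: k => [|k] //; rewrite iterS; apply: leq_trans (ff _).
rewrite leq_exp2l // leq_exp2l //.
have -> : (k.+1 + 3) * k.+1 = (k + 4) * (k + 1) by lia.
elim: k => [|k IH] //; rewrite iterS; apply: leq_trans (ff _).
set n := iter k f 4 in IH *.
have n1 : n.+1 <= 2 ^ n by exact: ltn_expl.
have : (2 ^ n).+1 <= 2 ^ 2 ^ n by exact: ltn_expl.
have : 2 ^ n.+1 <= 2 ^ 2 ^ n by rewrite leq_exp2l.
rewrite expnS; nia.
Qed.

Section Fast.
Variables (Phi : set formula) (V : zset -> Prop).
Hypotheses (VM : inner_model Phi V) (Ps : Phi succ_graph_formula)
  (Pi : Phi iter_graph_formula).

(** The successive iterates dominate doubling, then 2 ^ x, then a tower. *)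
Lemma V_fast : exists2 b, V (zset_of_real b) &
  forall k, 2 ^ block_size k <= b k.
Proof.
pose it f n := iter n (f \o f) 4.
have Vit f : V (zset_of_real f) -> V (zset_of_real (it f)).
  exact: (V_iter VM).
exists (it (it (it succn))); first exact/Vit/Vit/Vit/(V_succ VM).
have it1 x : 2 * x <= it succn x.
  by rewrite /it; elim: x => // x; rewrite iterS mulnS; exact: (@leq_add 2 _ 2).
have it2 x : 2 ^ x <= it (it succn) x.
  apply: iter_double_ge => y /=; have := it1 (it succn y); have := it1 y; lia.
move=> k; apply: iter_tower_ge => x /=; apply: leq_trans (it2 _).
by rewrite leq_exp2l.
Qed.

End Fast.

(** * The first uncountable ordinal *)

(** Double induction on membership: incomparable ordinals have the same
    elements. *)
Lemma ordinal_total x y : Defs.ordinal x -> Defs.ordinal y ->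
  [\/ x \eps y, x = y | y \eps x].
Proof.
have down u v : Defs.ordinal u -> v \eps u -> Defs.ordinal v.
  by move=> [tu eu] vu; split=> [|w wv]; [exact: eu|apply: eu; exact: tu vu].
elim/zset_ind_mem: x y => x IHx; elim/zset_ind_mem => y IHy ox oy.
have [xy|nxy] := pselect (x \eps y); first by constructor 1.
have [yx|nyx] := pselect (y \eps x); first by constructor 3.
constructor 2; apply: zset_ext => z; split=> zu.
  have [//|zy|yz] := IHx z zu y (down _ _ ox zu) oy.
    by case: nyx; rewrite -zy.
  by case: nyx; exact: ox.1 yz zu.
have [xz|xz|//] := IHy z zu ox (down _ _ oy zu).
  by case: nxy; exact: oy.1 xz zu.
by case: nxy; rewrite xz.
Qed.

Lemma injection_to_omega f a : injection f a omega ->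
  exists e : zset -> nat,
    forall x y, x \eps a -> y \eps a -> e x = e y -> x = y.
Proof.
move=> [fp ff fi].
have ex x : exists n, x \eps a -> opair x (numeral n) \eps f.
  have [xa|nxa] := pselect (x \eps a); last by exists 0.
  have [y [xyf _]] := ff x xa.
  have [u [v [_ /mem_omega[n ->] /opair_inj[_ yn]]]] := fp _ xyf.
  by exists n; rewrite -yn.
have [e eP] := choice ex; exists e => x y xa ya exy.
by apply: fi (eP x xa) _; rewrite exy; exact: eP.
Qed.

(** The type of the elements of a is too large to index a family; the branches of
    a tree that represents a are not. *)
Lemma zset_graph (f : zset -> zset) (a : zset) : exists g,
  forall p, p \eps g <-> exists2 x, x \eps a & p = opair x (f x).
Proof.
rewrite -(tree_ofK a); case: (tree_of a) => A F.
exists (zfamily (fun i => opair (zset_of (F i)) (f (zset_of (F i))))) => p.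
rewrite mem_zfamily; split=> [[i ->]|[x /mem_zset_of[i ->] ->]]; last by exists i.
by exists (zset_of (F i)) => //; apply/mem_zset_of; exists i.
Qed.

Section Omega1.
Variable w1 : zset.
Hypothesis w1P : is_omega1 univ w1.
Implicit Types a b c : elts w1.

Lemma elts_inj a b : sval a = sval b -> a = b.
Proof.
case: a b => [x p] [y q] /= E; subst y.
by congr exist; exact: Prop_irrelevance.
Qed.

Lemma lt_elts_total a b : [\/ lt_elts a b, a = b | lt_elts b a].
Proof.
have [_ [t e] _ _] := w1P.
have o c : Defs.ordinal (sval c).
  split=> [|z zc]; first exact/e/(svalP c).
  by apply: e; exact: t zc (svalP c).
case: (ordinal_total (o a) (o b)) => [|/elts_inj|]; by [constructor 1|constructor 2|constructor 3].
Qed.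

Lemma lt_elts_trans a b c : lt_elts a b -> lt_elts b c -> lt_elts a c.
Proof.
have [_ [t e] _ _] := w1P.
by move=> ab bc; exact: e (svalP c) _ _ ab bc.
Qed.

Lemma lt_elts_wf : well_founded (@lt_elts w1).
Proof.
have acc x : forall a, sval a = x -> Acc (@lt_elts w1) a.
  elim/zset_ind_mem: x => x IH a ax; constructor=> b ba.
  by apply: IH erefl; rewrite -ax.
by move=> a; exact: acc.
Qed.

Lemma lt_elts_countable a : exists e : elts w1 -> nat,
  forall b c, lt_elts b a -> lt_elts c a -> e b = e c -> b = c.
Proof.
have [_ _ _ /(_ _ (svalP a))[f _ /injection_to_omega[e eP]]] := w1P.
exists (fun b => e (sval b)) => b c ba ca ebc.
by apply: elts_inj; exact: eP ebc.
Qed.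

(** If a were the largest element, an injection of a into omega would extend to
    an injection of omega_1, sending a to 0 and shifting the others. *)
Lemma lt_elts_unbounded a : exists b, lt_elts a b.
Proof.
have [_ [t _] nc _] := w1P; apply: contrapT => na; apply: nc.
have below x : x \eps w1 -> x \eps sval a \/ x = sval a.
  move=> xw; pose b : elts w1 := exist _ x xw.
  by have [|<-|ab] := lt_elts_total b a; [left|right|case: na; exists b].
have [_ _ _ /(_ _ (svalP a))[f _ /injection_to_omega[e eP]]] := w1P.
pose g x := if pselect (x = sval a) is left _ then 0 else (e x).+1.
have gI x y : x \eps w1 -> y \eps w1 -> g x = g y -> x = y.
  rewrite /g => /below xa /below ya.
  case: pselect => [->|nx]; case: pselect => [->|ny] // [exy].
  by case: xa ya => // xa [ya|//]; exact: eP exy.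
have [G GP] := zset_graph (fun x => numeral (g x)) w1.
exists G => //; split=> [p /GP[x xw ->]|x xw|x x' y].
- by exists x, (numeral (g x)); split=> //; apply/mem_omega; exists (g x).
- exists (numeral (g x)); split; first by apply/GP; exists x.
  by move=> y /GP[z _ /opair_inj[-> ->]].
move=> /GP[u uw /opair_inj[-> ->]] /GP[v vw /opair_inj[-> /numeral_inj]].
exact: gI.
Qed.

End Omega1.

(** * Towers of length omega_1 in a countably closed order *)

Definition eventually (P : nat -> Prop) := exists K, forall k, K <= k -> P k.

Lemma eventually_all P : (forall k, P k) -> eventually P.
Proof. by move=> PP; exists 0. Qed.

Lemma eventually_and P Q :
  eventually P -> eventually Q -> eventually (fun k => P k /\ Q k).
Proof.
move=> [K PK] [L QL]; exists (maxn K L) => k; rewrite geq_max => /andP[Kk Lk].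
by split; [exact: PK|exact: QL].
Qed.

Lemma eventually_mono P Q :
  (forall k, P k -> Q k) -> eventually P -> eventually Q.
Proof. by move=> PQ [K PK]; exists K => k /PK /PQ. Qed.

(** The functions nat -> T are ordered by le almost everywhere.  The predicate
    [I k x] is the invariant of the values at k, and [r k x c] says that x has
    measure at least c at k.  Only functions whose measure tends to infinity are
    considered; a step that lowers the measure by one preserves this class. *)
Section CountableChains.
Variables (W : Type) (lt : W -> W -> Prop).
Hypothesis lt_total : forall a b, [\/ lt a b, a = b | lt b a].
Hypothesis lt_trans : forall a b c, lt a b -> lt b c -> lt a c.
Variables (S : W -> Prop) (e : W -> nat).
Hypothesis e_inj : forall a b, S a -> S b -> e a = e b -> a = b.

Lemma eventually_fin P m : (forall a, S a -> eventually (P a)) ->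
  eventually (fun k => forall a, S a -> e a < m -> P a k).
Proof.
move=> evP; elim: m => [|m IH]; first exact: eventually_all.
have [[a [Sa ea]]|na] := pselect (exists a, S a /\ e a = m); last first.
  apply: eventually_mono IH => k IH b Sb; rewrite ltnS leq_eqVlt.
  by case/orP => [/eqP eb|]; [case: na; exists b|exact: IH].
apply: eventually_mono (eventually_and IH (evP a Sa)) => k [{}IH Pa] b Sb.
rewrite ltnS leq_eqVlt => /orP[/eqP eb|]; last exact: IH.
by rewrite (e_inj Sb Sa) // eb.
Qed.

Lemma finite_chain_max m : (forall a, S a -> ~ e a < m) \/
  exists a, [/\ S a, e a < m & forall b, S b -> e b < m -> b = a \/ lt b a].
Proof.
elim: m => [|m IH]; first by left.
have [[a [Sa ea]]|na] := pselect (exists a, S a /\ e a = m); last first.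
  have le b : e b < m.+1 -> S b -> e b < m.
    rewrite ltnS leq_eqVlt => /orP[/eqP eb Sb|//].
    by case: na; exists b.
  case: IH => [IH|[a [Sa am aP]]]; first by left=> b Sb /le/(_ Sb)/(IH b Sb).
  right; exists a; split=> // [|b Sb /le/(_ Sb)/(aP b Sb)//]; exact: ltnW.
have le b : e b < m.+1 -> S b -> b = a \/ e b < m.
  rewrite ltnS leq_eqVlt => /orP[/eqP eb Sb|]; last by right.
  by left; apply: e_inj => //; rewrite eb.
right; case: IH => [IH|[c [Sc cm cP]]].
  exists a; split=> // [|b Sb /le/(_ Sb)[|/(IH b Sb)//]]; rewrite ?ea //.
  by left.
have [ac|ac|ca] := lt_total a c.
- exists c; split=> // [|b Sb /le/(_ Sb)[->|/(cP b Sb)//]]; last by right.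
  exact: ltnW.
- subst c; exists a; split=> // [|b Sb /le/(_ Sb)[->|/(cP b Sb)//]]; last by left.
  exact: ltnW.
exists a; split=> // [|b Sb /le/(_ Sb)[->|/(cP b Sb)[->|bc]]]; rewrite ?ea //.
- by left.
- by right.
by right; exact: lt_trans bc ca.
Qed.

Variables (T : Type) (le : T -> T -> Prop).
Variables (I : nat -> T -> Prop) (r : nat -> T -> nat -> Prop) (x0 : nat -> T).
Hypothesis le_refl : forall x, le x x.
Hypothesis r_mono : forall k x c c', c' <= c -> r k x c -> r k x c'.
Hypothesis I0 : forall k, I k (x0 k).
Hypothesis r0 : forall c, eventually (fun k => r k (x0 k) c).

(** Diagonalization: at k, take the value of the largest among the finitely many
    members of the chain with index below n, for n as large as k allows.  Here
    n is such that from k on these members are increasing and the largest one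
    has measure at least n. *)
Lemma countable_chain_bound (Y : W -> nat -> T) :
  (forall a k, S a -> I k (Y a k)) ->
  (forall a c, S a -> eventually (fun k => r k (Y a k) c)) ->
  (forall a b, S a -> S b -> lt a b -> eventually (fun k => le (Y a k) (Y b k))) ->
  exists X : nat -> T, [/\ forall k, I k (X k),
    forall c, eventually (fun k => r k (X k) c) &
    forall a, S a -> eventually (fun k => le (Y a k) (X k))].
Proof.
move=> IY rY leY.
pose U n k x := [/\ I k x, r k x n & forall a, S a -> e a < n -> le (Y a k) x].
have U_mono n n' k x : n' <= n -> U n k x -> U n' k x.
  move=> nn [Ix rx ax]; split=> //; first exact: r_mono rx.
  by move=> a Sa ea; apply: ax => //; exact: leq_trans nn.
have exU n : eventually (fun k => exists x, U n k x).
  have [nS|[a [Sa an aP]]] := finite_chain_max n.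
    apply: eventually_mono (r0 n) => k rk; exists (x0 k); split=> // a Sa.
    by move/nS: Sa.
  have evP b : S b -> eventually (fun k => e b < n -> le (Y b k) (Y a k)).
    move=> Sb; have [bn|nb] := pselect (e b < n); last first.
      by apply: eventually_all => k.
    have [->|ba] := aP b Sb bn; first exact: eventually_all.
    by apply: eventually_mono (leY b a Sb Sa ba) => k.
  apply: eventually_mono (eventually_and (rY a n Sa) (eventually_fin n evP)).
  move=> k [ra lea]; exists (Y a k); split=> //; first exact: IY.
  by move=> b Sb eb; exact: lea.
have [K KP] := choice exU.
have exX k : exists x, I k x /\ forall n, n <= k -> K n <= k -> U n k x.
  suff [x [Ix xP]] : exists x, I k x /\ forall n, n < k.+1 -> K n <= k -> U n k x.
    by exists x.
  elim: k.+1 => [|N [x [Ix xP]]]; first by exists (x0 k).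
  have [KN|KN] := leqP (K N) k.
    have [y Uy] := KP N k KN; exists y; split; first by case: Uy.
    by move=> n nN _; exact: U_mono Uy.
  exists x; split=> // n; rewrite ltnS leq_eqVlt => /orP[/eqP->|]; last exact: xP.
  by rewrite leqNgt KN.
have [X XP] := choice exX; exists X; split=> [k|c|a Sa]; first by case: (XP k).
  exists (maxn c (K c)) => k; rewrite geq_max => /andP[ck Kk].
  by case: (XP k) => _ /(_ c ck Kk) [].
exists (maxn (e a).+1 (K (e a).+1)) => k; rewrite geq_max => /andP[ck Kk].
by case: (XP k) => _ /(_ _ ck Kk) [_ _]; apply.
Qed.

End CountableChains.

Section Tower.
Variables (W : Type) (lt : W -> W -> Prop).
Hypothesis lt_total : forall a b, [\/ lt a b, a = b | lt b a].
Hypothesis lt_trans : forall a b c, lt a b -> lt b c -> lt a c.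
Hypothesis lt_wf : well_founded lt.
Hypothesis lt_countable : forall a, exists e : W -> nat,
  forall b c, lt b a -> lt c a -> e b = e c -> b = c.
Variables (T : Type) (le : T -> T -> Prop).
Variables (I : nat -> T -> Prop) (r : nat -> T -> nat -> Prop) (x0 : nat -> T).
Hypothesis le_refl : forall x, le x x.
Hypothesis le_trans : forall x y z, le x y -> le y z -> le x z.
Hypothesis r_mono : forall k x c c', c' <= c -> r k x c -> r k x c'.
Hypothesis I0 : forall k, I k (x0 k).
Hypothesis r0 : forall c, eventually (fun k => r k (x0 k) c).
Variable step : W -> nat -> T -> T.
Hypothesis step_I : forall a k x, I k x -> I k (step a k x).
Hypothesis step_le : forall a k x, I k x -> le x (step a k x).
Hypothesis step_r : forall a k x c, I k x -> r k x c.+1 -> r k (step a k x) c.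

(** Successor and limit stages are treated alike: stage b is an upper bound of
    the countable chain of the step [a (X a)] for a below b. *)
Lemma tower_exists : exists X : W -> nat -> T, forall b,
  [/\ forall k, I k (X b k), forall c, eventually (fun k => r k (X b k) c) &
      forall a, lt a b -> eventually (fun k => le (step a k (X a k)) (X b k))].
Proof.
(* The recursion picks an upper bound whenever there is one, from the earlier
   values completed by the default value x0; that there always is one is
   proved afterwards, by induction. *)
pose good (b : W) (Z : W -> nat -> T) (x : nat -> T) :=
  [/\ forall k, I k (x k), forall c, eventually (fun k => r k (x k) c) &
    forall a, lt a b -> eventually (fun k => le (step a k (Z a k)) (x k))].
have exF (bZ : W * (W -> nat -> T)) : exists x,
    (exists y, good bZ.1 bZ.2 y) -> good bZ.1 bZ.2 x.
  have [[x gx]|nx] := pselect (exists y, good bZ.1 bZ.2 y); first by exists x.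
  by exists x0 => /nx.
have [G GP] := choice exF; pose F b Z := G (b, Z).
have FP b Z : (exists x, good b Z x) -> good b Z (F b Z) by exact: (GP (b, Z)).
pose ext b (rec : forall a, lt a b -> nat -> T) a :=
  if pselect (lt a b) is left h then rec a h else x0.
pose X := Fix lt_wf (fun=> nat -> T) (fun b rec => F b (ext b rec)).
have XE b : X b = F b (ext b (fun a _ => X a)).
  rewrite /X Fix_eq // => a f g fg; congr (F a _).
  by apply/funext => c; rewrite /ext; case: pselect.
exists X; elim/(well_founded_ind lt_wf) => b IH.
suff : good b (ext b (fun a _ => X a)) (X b).
  case=> [? ? le_b]; split=> // a ab.
  by apply: eventually_mono (le_b a ab) => k; rewrite /ext; case: pselect.
rewrite XE; apply: FP; have [e eP] := lt_countable b.
have [|||x [Ix rx xP]] := @countable_chain_bound W lt lt_total lt_trans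
    (fun a => lt a b) e eP T le I r x0 le_refl r_mono I0 r0
    (fun a k => step a k (X a k)).
- by move=> a k /IH[Ia _ _]; exact: step_I.
- move=> a c /IH[Ia ra _]; apply: eventually_mono (ra c.+1) => k.
  exact: step_r.
- move=> a c ab cb ac; have [Ic _ /(_ a ac)] := IH c cb.
  apply: eventually_mono => k leac; apply: le_trans leac _.
  exact: step_le.
exists x; split=> // a ab; apply: eventually_mono (xP a ab) => k.
by rewrite /ext; case: pselect.
Qed.

End Tower.

(** * Block states *)

Definition bit (c i : nat) : bool := odd (c %/ 2 ^ i).

(** The trace of a set on N points, as a number below 2 ^ N. *)
Lemma bits_code (A : nat -> bool) N : exists c, c < 2 ^ N /\
  forall i, i < N -> bit c i = A i.
Proof.
elim: N A => [|N IH] A; first by exists 0.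
have [c [cN cP]] := IH (fun i => A i.+1); exists (A 0 + c.*2); split.
  by rewrite expnS mul2n; case: (A 0); lia.
move=> [_|i iN]; first by rewrite /bit divn1 oddD odd_double addbF oddb.
rewrite /bit expnS divnMA -cP // /bit; congr (odd (_ %/ _)).
by rewrite divn2 halfD odd_double andbF doubleK; case: (A 0).
Qed.

(** For each candidate, keep the larger of the two classes into which it splits
    the set. *)
Lemma homogeneous_subset (L E : seq nat) M : uniq E -> M * 2 ^ size L <= size E ->
  exists E', [/\ uniq E', {subset E' <= E}, M <= size E' &
    forall c i j, c \in L -> i \in E' -> j \in E' -> bit c i = bit c j].
Proof.
elim: L E M => [|c L IH] E M uE ME.
  by exists E; split=> //; move: ME; rewrite muln1.
have [b bE] : exists b, M * 2 ^ size L <= size [seq i <- E | bit c i == b].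
  have := count_predC (bit c) E => Esz.
  have [Mt|Mt] := leqP (M * 2 ^ size L) (count (bit c) E).
    by exists true; rewrite size_filter (eq_count (a2 := bit c)) // => i /=; case: bit.
  exists false; rewrite size_filter (eq_count (a2 := predC (bit c))).
    by move: ME; rewrite /= expnS; lia.
  by move=> i /=; case: bit.
have [E' [uE' sE' ME' hE']] := IH _ M (filter_uniq _ uE) bE.
have E'b i : i \in E' -> bit c i = b by move/sE'; rewrite mem_filter => /andP[/eqP].
exists E'; split=> // [i /sE'|d i j].
  by rewrite mem_filter => /andP[].
by rewrite inE => /orP[/eqP-> /E'b-> /E'b->|dL]; [|exact: hE'].
Qed.

(** The state of a block: an involution bf, whose domain is encoded as the set of
    points that it moves, and the reserve bE. *)
Record bstate := BState { bf : nat -> nat; bE : seq nat }.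

Definition bvalid k x :=
  [/\ involutive (bf x), forall i, bf x i <> i -> i < block_size k, uniq (bE x) &
      forall i, i \in bE x -> bf x i = i /\ i < block_size k].

(** The order of the construction: involutions grow, reserves shrink, and new
    points are taken from the reserve. *)
Definition bext x y :=
  [/\ forall i, bf x i <> i -> bf y i = bf x i, {subset bE y <= bE x} &
      forall i, bf y i <> i -> bf x i <> i \/ i \in bE x].

(** The base 2 ^ (k + 3) pays for k + 1 halvings and for the two points swapped
    afterwards, since 4 * n >= n + 2 for n > 0. *)
Definition brank k x c := 2 ^ ((k + 3) * c) <= size (bE x).

Lemma bext_refl x : bext x x.
Proof. by split=> // i; left. Qed.

Lemma bext_trans x y z : bext x y -> bext y z -> bext x z.
Proof.
move=> [xy1 xy2 xy3] [yz1 yz2 yz3]; split=> [i xi|i /yz2/xy2//|i /yz3[/xy3//|]].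
  by rewrite yz1 xy1.
by move/xy2; right.
Qed.

Lemma brank_mono k x c c' : c' <= c -> brank k x c -> brank k x c'.
Proof.
move=> cc; apply: leq_trans; rewrite leq_exp2l // leq_pmul2l //; lia.
Qed.

(** Both involutions coincide on the points that the smaller one moves, and this
    set is stable under them; hence so is its complement. *)
Lemma bext_fixed k x y i : bvalid k x -> bvalid k y -> bext x y ->
  bf x i = i -> bf x (bf y i) = bf y i.
Proof.
move=> [xK _ _ _] [yK _ _ _] [xy _ _] xi.
apply: contrapT => xj; have := xy _ xj; rewrite yK => ixj.
by apply: xj; rewrite -ixj -(xK (bf y i)) -ixj.
Qed.

(** The promise made at a step from x to y: no matter how y is extended later,
    a point not moved by x is sent to a point that no candidate in L
    separates from it. *)
Definition homogeneous_above k (L : seq nat) x y := forall z, bvalid k z ->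
  bext y z -> forall c i, c \in L -> bf z i <> i -> bf x i = i ->
  bit c (bf z i) = bit c i.

(** New points come from the swap or from the reserve of y, hence from E, and
    so do their images by bext_fixed. *)
Lemma homogeneous_aboveI k (L E : seq nat) x y : bvalid k x -> bext x y ->
  (forall c i j, c \in L -> i \in E -> j \in E -> bit c i = bit c j) ->
  {subset bE y <= E} -> (forall i, bf y i <> i -> bf x i = i -> i \in E) ->
  homogeneous_above k L x y.
Proof.
move=> vx xy hE yE yfE z vz yz c i cL zi xi.
have zE l : bf z l <> l -> bf x l = l -> l \in E.
  have [_ _ zy] := yz.
  by move=> zl xl; have [yl|/yE//] := zy l zl; exact: yfE.
apply: hE => //; last exact: zE; apply: zE.
  by have [zK _ _ _] := vz; rewrite zK => izi; exact: zi.
exact: bext_fixed vx vz (bext_trans xy yz) xi.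
Qed.

(** When the homogeneous part has less than two points, nothing is swapped and
    the reserve is emptied, which keeps the promise trivially; this happens only
    when the reserve of x has measure less than one. *)
Lemma step_exists k x L : bvalid k x -> size L <= k.+1 -> exists y,
  [/\ bvalid k y, bext x y, homogeneous_above k L x y &
      forall c, brank k x c.+1 ->
        brank k y c /\ exists i, bf y i <> i /\ bf x i = i].
Proof.
move=> vx Lk; have [xK xN uE Ex] := vx.
have [|E [uE' sE ME hE]] :=
    @homogeneous_subset L (bE x) (size (bE x) %/ 2 ^ k.+1) uE.
  apply: leq_trans (leq_trunc_div _ (2 ^ k.+1)).
  by rewrite leq_mul2l leq_exp2l // Lk orbT.
have rE c : brank k x c.+1 -> 2 ^ ((k + 3) * c) + 2 <= size E.
  rewrite /brank => xc; apply: leq_trans ME.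
  rewrite leq_divRL ?expn_gt0 //; apply: leq_trans xc.
  have -> : (k + 3) * c.+1 = (k + 3) * c + (2 + k.+1) by lia.
  rewrite !expnD mulnA leq_mul2r; apply/orP; right.
  have : 0 < 2 ^ ((k + 3) * c) by rewrite expn_gt0.
  by move: (2 ^ ((k + 3) * c)) => n; lia.
case: E uE' sE hE ME rE => [|a [|b E]] uE' sE hE ME rE.
- exists (BState (bf x) [::]); split=> // [||c /rE]; last by rewrite addn2.
    by split=> // i; left.
  by apply: (homogeneous_aboveI vx _ hE) => //=; split=> // i; left.
- exists (BState (bf x) [::]); split=> // [||c /rE]; last by rewrite addn2 ltnS.
    by split=> // i; left.
  by apply: (homogeneous_aboveI vx _ hE) => //=; split=> // i; left.
have [xa aN] : bf x a = a /\ a < block_size k by apply/Ex/sE; rewrite mem_head.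
have [xb bN] : bf x b = b /\ b < block_size k.
  by apply/Ex/sE; rewrite !inE eqxx orbT.
move: uE'; rewrite /= inE negb_or -andbA => /and4P[ab aE bE_ uE'].
pose f i := if i == a then b else if i == b then a else bf x i.
have fa : f a = b by rewrite /f eqxx.
have fb : f b = a by rewrite /f eq_sym (negPf ab) eqxx.
have fo i : i != a -> i != b -> f i = bf x i by rewrite /f => /negPf-> /negPf->.
have xf : bext x (BState f E).
  split=> [i xi|i iE|i] /=.
  - by apply: fo; apply/eqP => ii; apply: xi; rewrite ii.
  - by apply: sE; rewrite !inE iE !orbT.
  have [->|ia] := eqVneq i a; first by right; apply: sE; rewrite mem_head.
  have [->|ib] := eqVneq i b; first by right; apply: sE; rewrite !inE eqxx orbT.
  by rewrite fo // => ?; left.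
exists (BState f E); split=> // [||c /rE]; last 1 first.
- rewrite addn2 !ltnS => cE; split=> //=; exists a; split=> //.
  by rewrite fa; apply/eqP; rewrite eq_sym.
- split=> //= [i|i|i iE]; last 1 first.
  + have [|xi iN] := Ex i; first by apply: sE; rewrite !inE iE !orbT.
    split=> //; rewrite fo //; first by apply: contraNneq aE => <-.
    by apply: contraNneq bE_ => <-.
  + have [->|ia] := eqVneq i a; first by rewrite fa.
    have [->|ib] := eqVneq i b; first by rewrite fb.
    rewrite (fo i) // fo //; apply: contraNneq ia; last first.
      by move=> xib; case/eqP: ib; rewrite -(xK i) xib.
    by move=> xia; rewrite -(xK i) xia xa.
  have [->|ia] := eqVneq i a; first by [].
  have [->|ib] := eqVneq i b; first by [].
  by rewrite fo //; exact: xN.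
apply: (homogeneous_aboveI vx xf hE) => /= i; first by rewrite !inE => ->; rewrite !orbT.
have [->|ia] := eqVneq i a; first by rewrite mem_head.
have [->|ib] := eqVneq i b; first by rewrite !inE eqxx orbT.
by rewrite fo.
Qed.

Section TowerOfStates.
Variables (W : Type) (lt : W -> W -> Prop).
Hypothesis lt_total : forall a b, [\/ lt a b, a = b | lt b a].
Hypothesis lt_trans : forall a b c, lt a b -> lt b c -> lt a c.
Hypothesis lt_wf : well_founded lt.
Hypothesis lt_countable : forall a, exists e : W -> nat,
  forall b c, lt b a -> lt c a -> e b = e c -> b = c.
Variable L : W -> nat -> seq nat.
Hypothesis L_size : forall a k, size (L a k) <= k.+1.

Lemma state_tower : exists X Y : W -> nat -> bstate,
  [/\ forall a k, bvalid k (X a k), forall a k, bext (X a k) (Y a k),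
      forall a k, homogeneous_above k (L a k) (X a k) (Y a k),
      forall a, eventually (fun k => exists i, bf (Y a k) i <> i /\ bf (X a k) i = i) &
      forall a b, lt a b -> eventually (fun k => bext (Y a k) (X b k))].
Proof.
have ex_step (akx : W * nat * bstate) : exists y,
    let: (a, k, x) := akx in bvalid k x ->
    [/\ bvalid k y, bext x y, homogeneous_above k (L a k) x y &
      forall c, brank k x c.+1 ->
        brank k y c /\ exists i, bf y i <> i /\ bf x i = i].
  move: akx => [[a k] x]; have [vx|nvx] := pselect (bvalid k x); last by exists x.
  by have [y ?] := step_exists vx (L_size a k); exists y.
have [s sP] := choice ex_step; pose step a k x := s (a, k, x).
have stepP a k x := sP (a, k, x).
pose x0 k := BState id (iota 0 (block_size k)).
have I0 k : bvalid k (x0 k).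
  split=> //=; first exact: iota_uniq.
  by move=> i; rewrite mem_iota add0n => /andP[].
have r0 c : eventually (fun k => brank k (x0 k) c).
  exists c => k ck; rewrite /brank /= size_iota /block_size leq_exp2l //.
  by rewrite leq_pmul2l //; lia.
have [a k x vx|a k x vx|a k x c vx|X XP] := tower_exists lt_total lt_trans lt_wf lt_countable
  bext_refl bext_trans brank_mono I0 r0 (step := step).
- by case: (stepP a k x vx).
- by case: (stepP a k x vx).
- by case: (stepP a k x vx) => _ _ _ cP /cP[].
have vX a k : bvalid k (X a k) by case: (XP a).
exists X, (fun a k => step a k (X a k)); split=> // [a k|a k|a|a b ab].
- by case: (stepP a k _ (vX a k)).
- by case: (stepP a k _ (vX a k)).
- have [_ /(_ 1) rX _] := XP a; apply: eventually_mono rX => k.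
  by case: (stepP a k _ (vX a k)) => _ _ _ /(_ 0) cP /cP[].
by case: (XP b) => _ _; apply.
Qed.

End TowerOfStates.

(** * The bowtie *)

Definition glob (X : nat -> bstate) (x : nat) : nat :=
  if (@pickle_inv (nat * nat)%type x) is Some (k, i) then pickle (k, bf (X k) i) else x.

Lemma glob_pickle X k i : glob X (pickle (k, i)) = pickle (k, bf (X k) i).
Proof. by rewrite /glob pickleK_inv. Qed.

Lemma glob_moved X x : glob X x <> x -> exists k i,
  x = pickle (k, i) /\ bf (X k) i <> i.
Proof.
rewrite /glob; case E : (pickle_inv x) => [[k i]|] // xi; exists k, i.
have xE : x = pickle (k, i) by have := @pickle_invK (nat * nat)%type x; rewrite E.
by split=> // ii; apply: xi; rewrite ii.
Qed.

Lemma globK X : (forall k, bvalid k (X k)) -> involutive (glob X).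
Proof.
move=> vX x; have [xx|/glob_moved[k [i [-> _]]]] := pselect (glob X x = x).
  by rewrite !xx.
by rewrite !glob_pickle; have [-> _ _ _] := vX k.
Qed.

Lemma pickle_inj2 (k l i j : nat) : pickle (k, i) = pickle (l, j) -> k = l /\ i = j.
Proof. by move/(pcan_inj pickleK) => -[]. Qed.

Lemma glob_fixed X k i : glob X (pickle (k, i)) = pickle (k, i) <-> bf (X k) i = i.
Proof.
by rewrite glob_pickle; split=> [/pickle_inj2[]|->].
Qed.

(** Finitely many blocks contain only finitely many moved points. *)
Lemma finite_exceptions X (P : nat -> Prop) : (forall k, bvalid k (X k)) ->
  eventually (fun k => forall i, bf (X k) i <> i -> P (pickle (k, i))) ->
  finite_set [set x | glob X x <> x /\ ~ P x].
Proof.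
move=> vX [K KP].
pose s := [seq pickle (k, i) | k <- iota 0 K, i <- iota 0 (block_size k)].
apply: sub_finite_set (finite_seq s) => x [/glob_moved[k [i [-> ki]]] nP] /=.
have [_ iN _ _] := vX k; apply/allpairsPdep; exists k, i.
rewrite !mem_iota !add0n /= iN //; split=> //.
by rewrite ltnNge; apply/negP => Kk; apply: nP; exact: KP.
Qed.

(** A finite set meets only finitely many blocks. *)
Lemma infinite_blocks (B : set nat) :
  eventually (fun k => exists i : nat, B (pickle (k, i))) -> infinite_set B.
Proof.
move=> [K KB] finB; apply: infinite_nat.
pose blk x := if (@pickle_inv (nat * nat)%type x) is Some (k, _) then k else 0.
have : finite_set (`I_K `|` blk @` B).
  by rewrite finite_setU; split; [exact: finite_II|exact: finite_image].
apply: sub_finite_set => k _; have [Kk|kK] := leqP K k; last by left.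
by right; have [i Bi] := KB k Kk; exists (pickle (k, i)) => //; rewrite /blk pickleK_inv.
Qed.

(** [L a k] lists the candidates offered at stage a in block k. *)
Section BowtieOfTower.
Variable w1 : zset.
Hypothesis w1P : is_omega1 univ w1.
Variable L : elts w1 -> nat -> seq nat.
Hypothesis L_size : forall a k, size (L a k) <= k.+1.
Hypothesis L_guess : forall A : nat -> nat -> bool, exists a, forall k,
  exists2 c, c \in L a k & forall i, i < block_size k -> bit c i = A k i.

Lemma bowtie_exists : exists f : elts w1 -> pfun, bowtie f.
Proof.
have [X [Y [vX XY hXY newY YX]]] := state_tower (lt_elts_total w1P)
  (lt_elts_trans w1P) (@lt_elts_wf w1) (lt_elts_countable w1P) L_size.
have extX a b : lt_elts a b -> eventually (fun k => bext (X a k) (X b k)).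
  by move=> /YX; apply: eventually_mono => k; exact: bext_trans.
pose F a := glob (X a); have FK a : involutive (F a) by exact: globK.
have coherent a b : lt_elts a b -> finite_set [set x | F a x <> x /\ ~ (F b x = F a x)].
  move=> ab; apply: finite_exceptions => //.
  by apply: eventually_mono (extX a b ab) => k [e1 _ _] i /e1; rewrite /F !glob_pickle => ->.
exists (fun a => PFun [set x | F a x <> x] (F a)); split=> [a|a b ab|a b|A] /=.
- split=> //; split=> [x /= xx|x y _ _ /(inv_inj (FK a))//|x /= xx].
    by move=> /(inv_inj (FK a)).
  by exists (F a x); rewrite /= ?FK // => E; apply: xx.
- split.
    by apply: sub_finite_set (coherent a b ab) => x /= [xx bx]; split=> // E; apply: bx; rewrite E.
  apply: infinite_blocks; apply: eventually_mono (eventually_and (newY a) (YX a b ab)).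
  move=> k [[i [yi xi]] [e1 _ _]]; exists i; split=> /=.
    by rewrite glob_fixed e1.
  by apply; rewrite glob_fixed.
- move=> [->|ab]; split; rewrite /= ?setIid; try exact: eqfin_refl.
  + rewrite (_ : [set x | _] = [set x | F b x <> x]); first exact: eqfin_refl.
    by apply/seteqP; split=> x /=; tauto.
  + apply: sub_finite_set (coherent a b ab) => x; rewrite setY_def /=.
    case=> [[xa nab]|[[_ xa]//]]; split=> // E; apply: nab.
    by rewrite E.
  apply: sub_finite_set (coherent a b ab) => x; rewrite setY_def /=.
  case=> [[[xb xa] nab]|[[[_ xba] _] /(_ xba)//]]; split=> // E; apply: nab.
  by rewrite E.
have [d dP] := L_guess (fun k i => `[< A (pickle (k, i)) >]); exists d => a da.
pose P x := F d x = x -> F d (F a x) = F a x /\ (A (F a x) <-> A x).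
have finP : finite_set [set x | F a x <> x /\ ~ P x].
  apply: finite_exceptions => //; case: da => [ad|da].
    by apply: eventually_all => k i ki; rewrite /P ad glob_fixed.
  apply: eventually_mono (YX d a da) => k ya i ki.
  rewrite /P /F glob_fixed glob_pickle => xi.
  have xa := bext_trans (XY d k) ya; split.
    by rewrite glob_fixed; exact: bext_fixed xa xi.
  have [c cL cP] := dP k; have := hXY d k _ (vX a k) ya c i cL ki xi.
  have [aK aN _ _] := vX a k; rewrite !cP ?aN //; last by rewrite aK => /esym.
  by move=> E; split=> /asboolP; [rewrite E|rewrite -E] => /asboolP.
have main (B : set nat) : (forall x, P x -> F d x = x -> (B (F a x) <-> B x)) ->
    pimage (PFun [set x | F a x <> x] (F a))
      (([set x | F a x <> x] `\` [set x | F d x <> x]) `&` B) =*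
    (([set x | F a x <> x] `\` [set x | F d x <> x]) `&` B).
  move=> PB.
  have : finite_set ([set x | F a x <> x /\ ~ P x] `|`
                     F a @` [set x | F a x <> x /\ ~ P x]).
    by rewrite finite_setU; split=> //; exact: finite_image.
  apply: sub_finite_set => y; rewrite setY_def /pimage /=.
  case=> [[[x [_ [[xa /contrapT xd] Bx]] <-] nFx]|[[[ya /contrapT yd] By] ny]].
    right; exists x => //; split=> // Px; apply: nFx; have [dx _] := Px xd.
    by do !split=> //=; [rewrite FK => /esym|exact: (PB x Px xd).2].
  left; split=> // Py; apply: ny; have [dy _] := Py yd.
  exists (F a y); rewrite ?FK //.
  by do !split=> //=; do ?[exact/nesym|exact: (PB y Py yd).2].
split; first by apply: main => x Px xd; case: (Px xd).
rewrite setDE; apply: main => x Px xd; case: (Px xd) => _ E.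
by split=> nA /E.
Qed.

End BowtieOfTower.

(** * From bowties to automorphisms *)

Definition almost (P : nat -> Prop) := finite_set [set x | ~ P x].

Lemma almost_mono P Q : (forall x, P x -> Q x) -> almost P -> almost Q.
Proof. by move=> PQ; apply: sub_finite_set => x /= nQ /PQ. Qed.

Lemma almost_and P Q : almost P -> almost Q -> almost (fun x => P x /\ Q x).
Proof.
move=> aP aQ; have : finite_set ([set x | ~ P x] `|` [set x | ~ Q x]).
  by rewrite finite_setU.
apply: sub_finite_set => x /=; have [Px|nPx] := pselect (P x); last by left.
by move=> nPQ; right=> Qx; exact: nPQ.
Qed.

Lemma almost_comp h P : injective h -> almost P -> almost (fun x => P (h x)).
Proof.
move=> hI aP; apply: finite_preimage aP => x y _ _; exact: hI.
Qed.

Lemma eqfin_almost A B : A =* B <-> almost (fun x => A x <-> B x).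
Proof.
rewrite /eqfin /almost (_ : A `+` B = [set x | ~ (A x <-> B x)]) //.
apply/seteqP; split=> x; rewrite setY_def /=; first by tauto.
by have [|] := pselect (A x); have [|] := pselect (B x); tauto.
Qed.

(** Greedy coloring: x has at most two neighbors in the graph of R, one as a
    source and one as a target, so that at most two colors are forbidden by the
    neighbors below x. *)
Lemma three_coloring (R : nat -> nat -> Prop) :
  (forall x y z, R x y -> R x z -> y = z) ->
  (forall x y z, R x z -> R y z -> x = y) ->
  (forall x, ~ R x x) ->
  exists2 c : nat -> nat, forall x, c x < 3 & forall x y, R x y -> c x <> c y.
Proof.
move=> Rf Ri Rirr.
have ex_new (sn : (nat -> nat) * nat) : exists v, v < 3 /\
    forall m, R sn.2 m \/ R m sn.2 -> sn.1 m <> v.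
  case: sn => s n /=.
  have [p pP] : exists p, forall m, R n m -> s m = p.
    have [[m nm]|no] := pselect (exists m, R n m); last by exists 0 => m ?; case: no; exists m.
    by exists (s m) => m' /(Rf _ _ _ nm) ->.
  have [q qP] : exists q, forall m, R m n -> s m = q.
    have [[m nm]|no] := pselect (exists m, R m n); last by exists 0 => m ?; case: no; exists m.
    by exists (s m) => m' /(Ri _ _ _ nm) ->.
  have [v [v3 vp vq]] : exists v, [/\ v < 3, v <> p & v <> q].
    have [p0|p0] := eqVneq p 0; have [q0|q0] := eqVneq q 0;
      have [p1|p1] := eqVneq p 1; have [q1|q1] := eqVneq q 1;
      by [exists 0; split; lia|exists 1; split; lia|exists 2; split; lia].
  by exists v; split=> // m [/pP ->|/qP ->] /esym.
have [new newP] := choice ex_new.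
(* st n is the coloring of the numbers below n, completed by 0. *)
pose st n := iteri n (fun n s x => if x == n then new (s, n) else s x) (fun=> 0).
pose c x := new (st x, x).
have stS n x : st n.+1 x = if x == n then new (st n, n) else st n x by [].
have stE n x : x < n -> st n x = c x.
  elim: n => [|n IH] //; rewrite ltnS leq_eqVlt stS.
  by case: eqP => [->|].
exists c => [x|x y Rxy]; first by case: (newP (st x, x)).
have [xy|yx|E] := ltngtP x y; last by case: (Rirr x); rewrite {2}E.
- have [_ /(_ x (or_intror Rxy))] := newP (st y, y).
  by rewrite /= stE.
have [_ /(_ y (or_introl Rxy))] := newP (st x, x).
by rewrite /= stE // => /nesym.
Qed.

Section AutomorphismOfBowtie.
Variable w1 : zset.
Hypothesis w1P : is_omega1 univ w1.
Variable f : elts w1 -> pfun.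
Hypothesis fP : bowtie f.
Implicit Types (a b d : elts w1) (A B : set nat).

Local Notation D a := (pdom (f a)).

Definition hat a x := if pselect (D a x) is left _ then papp (f a) x else x.

Lemma hat_dom a x : D a x -> hat a x = papp (f a) x.
Proof. by rewrite /hat; case: pselect. Qed.

Lemma hat_out a x : ~ D a x -> hat a x = x.
Proof. by rewrite /hat; case: pselect. Qed.

Lemma dom_hat a x : D a (hat a x) <-> D a x.
Proof.
have [/(_ a)[[fD _ _] _] _ _ _] := fP.
have [Dx|nDx] := pselect (D a x); last by rewrite hat_out.
by split=> // _; rewrite hat_dom //; exact: fD.
Qed.

Lemma hat_inj a : injective (hat a).
Proof.
have [/(_ a)[[_ fI _] _] _ _ _] := fP => x y E.
have Dxy : D a x <-> D a y by rewrite -dom_hat E dom_hat.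
have [Dx|nDx] := pselect (D a x).
  move: E; rewrite !hat_dom //; last exact/Dxy.
  by apply: fI; rewrite inE //; exact/Dxy.
by move: E; rewrite !hat_out // -Dxy.
Qed.

Lemma hat_surj a y : exists x, hat a x = y.
Proof.
have [/(_ a)[[_ _ fS] _] _ _ _] := fP.
have [Dy|nDy] := pselect (D a y); last by exists y; rewrite hat_out.
by have [x Dx <-] := fS y Dy; exists x; rewrite hat_dom.
Qed.

Lemma le_elts_dir a b : exists c, le_elts a c /\ le_elts b c.
Proof.
have [ab|->|ba] := lt_elts_total w1P a b.
- by exists b; split; [right|left].
- by exists b; split; left.
by exists a; split; [left|right].
Qed.

Lemma le_elts_trans a b c : le_elts a b -> le_elts b c -> le_elts a c.
Proof.
case=> [->//|ab] [<-|bc]; right=> //; exact: lt_elts_trans bc.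
Qed.

Lemma hat_coherent a b : le_elts a b ->
  almost (fun x => D a x -> D b x /\ hat b x = hat a x).
Proof.
have [_ _ + _] := fP => /(_ a b) + ab => /(_ ab)[/eqfin_almost E1 /eqfin_almost E2].
apply: almost_mono (almost_and E1 E2) => x /= [E1x E2x] Dx.
have Dbx : D b x by case: E1x => /(_ Dx)[].
by split=> //; rewrite !hat_dom //; case: E2x => /(_ (conj Dbx Dx))[].
Qed.

(** The third clause of a bowtie, read pointwise: almost every point of A in the
    new part of the domain is sent into A by injectivity, and likewise for the
    complement of A. *)
Lemma hat_guess A : exists d, forall a, le_elts d a ->
  almost (fun x => D a x -> ~ D d x ->
    ~ D d (hat a x) /\ (A (hat a x) <-> A x)).
Proof.
have [_ _ _ /(_ A)[d dP]] := fP; exists d => a /dP /=[/eqfin_almost E1 /eqfin_almost E2].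
apply: almost_mono (almost_and (almost_comp (@hat_inj a) E1) (almost_comp (@hat_inj a) E2)).
move=> x [E1x E2x] Dx nDx.
have [Ax|nAx] := pselect (A x).
  have : pimage (f a) ((D a `\` D d) `&` A) (hat a x) by exists x; rewrite ?hat_dom.
  by move=> /E1x[[_ ?] ?].
have : pimage (f a) ((D a `\` D d) `\` A) (hat a x) by exists x; rewrite ?hat_dom.
by move=> /E2x[[_ ?] ?].
Qed.

(** On the old domain the two functions agree by coherence; on the new part
    hat d is the identity, and hat a preserves A almost everywhere. *)
Lemma hat_stable A d : (forall a, le_elts d a ->
  almost (fun x => D a x -> ~ D d x ->
    ~ D d (hat a x) /\ (A (hat a x) <-> A x))) ->
  forall a, le_elts d a -> almost (fun x => A (hat a x) <-> A (hat d x)).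
Proof.
move=> dP a da; apply: almost_mono (almost_and (dP a da) (hat_coherent da)).
move=> x [xP cx]; have [Ddx|nDdx] := pselect (D d x).
  by have [_ ->] := cx Ddx.
rewrite (hat_out nDdx); have [Dax|nDax] := pselect (D a x).
  by have [] := xP Dax nDdx.
by rewrite hat_out.
Qed.

(** The map sends a class to its eventual preimage.  Preimages, rather than
    images, make it commute with the Boolean operations for free. *)
Lemma eventual_pullback : exists phi : PFin -> PFin, forall A,
  exists d, forall a, le_elts d a -> phi (cls A) = cls (hat a @^-1` A).
Proof.
have [del delP] := choice hat_guess.
exists (fun x => cls (hat (del (rpr x)) @^-1` rpr x)) => A.
exists (del (rpr (cls A))) => a da; apply/clsP/eqfin_almost.
have /clsP/eqfin_almost rA := rprK (cls A).
apply: almost_mono (almost_and (hat_stable (delP _) da) (almost_comp (@hat_inj a) rA)).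
by move=> x /=[E1 E2]; rewrite -E1.
Qed.

Section EventualPullback.
Variable phi : PFin -> PFin.
Hypothesis phiP : forall A, exists d, forall a, le_elts d a ->
  phi (cls A) = cls (hat a @^-1` A).

Lemma pullback_common A B : exists a,
  phi (cls A) = cls (hat a @^-1` A) /\ phi (cls B) = cls (hat a @^-1` B).
Proof.
have [[d dP] [e eP]] := (phiP A, phiP B).
by have [a [da ea]] := le_elts_dir d e; exists a; rewrite (dP a) // (eP a).
Qed.

Lemma pullback_above A d : exists2 a, le_elts d a & phi (cls A) = cls (hat a @^-1` A).
Proof.
have [e eP] := phiP A; have [a [da ea]] := le_elts_dir d e.
by exists a; rewrite ?(eP a).
Qed.

(** Every Boolean identity, and injectivity, holds because it holds for the
    permutation hat a with a large.  A preimage of the class of B is the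
    class of the image of B under hat d, for d as in hat_guess. *)
Lemma pullback_automorphism : automorphism phi.
Proof.
have phi_inj : injective phi.
  move=> x y; rewrite -(rprK x) -(rprK y); move: (rpr x) (rpr y) => A B.
  have [a [-> ->]] := pullback_common A B => /clsP/eqfin_almost AB.
  apply/clsP/eqfin_almost.
  have [h hP] := choice (hat_surj a).
  have hI : injective h by exact: can_inj hP.
  by apply: almost_mono (almost_comp hI AB) => z /=; rewrite hP.
have phi_surj y : exists x, phi x = y.
  rewrite -(rprK y); move: (rpr y) => B; have [d dP] := hat_guess B.
  exists (cls (hat d @` B)).
  have [a da ->] := pullback_above (hat d @` B) d; apply/clsP/eqfin_almost.
  apply: almost_mono (almost_and (dP a da) (hat_coherent da)) => x [xP cx] /=.
  have imE z : (hat d @` B) (hat d z) <-> B z.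
    by split=> [[u Bu /hat_inj <-]//|Bz]; exists z.
  have [Ddx|nDdx] := pselect (D d x); first by have [_ ->] := cx Ddx; exact: imE.
  have [Dax|nDax] := pselect (D a x).
    have [nd <-] := xP Dax nDdx.
    by have := imE (hat a x); rewrite hat_out.
  by rewrite (hat_out nDax); have := imE x; rewrite hat_out.
have [g gP] := choice phi_surj; split.
- by exists g => // x; apply: phi_inj; rewrite gP.
- move=> x y; rewrite -(rprK x) -(rprK y); move: (rpr x) (rpr y) => A B.
  rewrite joinFinE; have [d dP] := phiP A; have [e eP] := phiP B.
  have [c [dc ec]] := le_elts_dir d e; have [a ca ->] := pullback_above (A `|` B) c.
  by rewrite (dP a) ?(eP a) ?joinFinE //; exact: le_elts_trans ca.
- move=> x y; rewrite -(rprK x) -(rprK y); move: (rpr x) (rpr y) => A B.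
  rewrite meetFinE; have [d dP] := phiP A; have [e eP] := phiP B.
  have [c [dc ec]] := le_elts_dir d e; have [a ca ->] := pullback_above (A `&` B) c.
  by rewrite (dP a) ?(eP a) ?meetFinE //; exact: le_elts_trans ca.
move=> x; rewrite -(rprK x); move: (rpr x) => A.
by rewrite complFinE; have [a [-> ->]] := pullback_common A (~` A); rewrite complFinE.
Qed.

(** Otherwise g o hat a is an injection without fixed points on an infinite part
    X of the domain of f a.  Coloring X with three colors so that this map
    always changes the color, one of the color classes is an infinite set B
    disjoint from its image under g o hat a.  But phi sends the image of B under
    hat a to the class of B, so the two sets should agree modulo finite. *)
Lemma trivial_inverts_hat (g : pfun) (C : set nat) a :
  finite_set (~` pdom g) -> set_bij (pdom g) C (papp g) ->
  (forall A, phi (cls A) = cls (pimage g A)) ->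
  almost (fun x => D a x -> pdom g (hat a x) /\ papp g (hat a x) = x).
Proof.
move=> gdom [_ gI _] phig.
pose X x := [/\ D a x, pdom g (hat a x) & papp g (hat a x) <> x].
suff finX : almost (fun x => ~ X x).
  apply: almost_mono (almost_and (almost_comp (@hat_inj a) gdom) finX).
  move=> x [gx nX] Dx; split=> //; apply: contrapT => ngx; exact: nX.
pose R x y := [/\ X x, X y & papp g (hat a x) = y].
have [|||c c3 cP] := @three_coloring R.
- by move=> x y z [_ _ <-] [_ _ <-].
- move=> x y z [[_ gx _] _ <-] [[_ gy _] _ /gI E].
  by apply: (@hat_inj a); rewrite E ?inE.
- by move=> x [[_ _ ne] _ E]; exact: ne.
have fin v : almost (fun x => ~ (X x /\ c x = v)).
  pose B x := X x /\ c x = v.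
  have [b ab phib] := pullback_above (hat a @` B) a.
  have := phig (hat a @` B); rewrite phib => /clsP/eqfin_almost E.
  apply: almost_mono (almost_and E (hat_coherent ab)) => x /=[Ex cx] [Xx cv].
  have [Dx gx _] := Xx; have [_ hx] := cx Dx.
  have /Ex[y [gy [z [Xz zv] zy]]] : (hat a @` B) (hat b x).
    by rewrite hx; exists x.
  by move=> zx; apply: (cP z x); [split; rewrite ?zy|rewrite zv cv].
apply: almost_mono (almost_and (fin 0) (almost_and (fin 1) (fin 2))).
move=> x [n0 [n1 n2]] Xx; have := c3 x.
by case E : (c x) => [|[|[|]]] // _; [apply: n0|apply: n1|apply: n2].
Qed.

(** The map g does not depend on a, so its three color classes are sets to which
    the third clause of the bowtie applies from some stage d on.  Beyond d,
    f a has to preserve the colors almost everywhere on an infinite set, while g,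
    its inverse there, changes them. *)
Lemma pullback_nontrivial : ~ trivial_automorphism phi.
Proof.
move=> [g [C [gdom _ gbij phig]]].
have inv a := trivial_inverts_hat a gdom gbij phig.
have [_ gI _] := gbij.
pose R x y := [/\ pdom g x, papp g x <> x & papp g x = y].
have [||x [_]//|c c3 cP] := @three_coloring R.
- by move=> x y z [_ _ <-] [_ _ <-].
- by move=> x y z [gx _ <-] [gy _ /gI]; rewrite !inE => ->.
have [e eP] := choice (fun v => hat_guess [set x | c x = v]).
have [d0 [e0 e1]] := le_elts_dir (e 0) (e 1).
have [d [d0d e2]] := le_elts_dir d0 (e 2).
have [a da] := lt_elts_unbounded w1P d.
have le_da : le_elts d a by right.
have good v : le_elts (e v) d -> almost (fun x => D a x -> ~ D d x ->
    (c (hat a x) = v <-> c x = v)).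
  move=> vd; have va := le_elts_trans vd le_da.
  apply: almost_mono (almost_and (eP v a va) (hat_coherent vd)) => x [xP cx] Dx nDx.
  by have [|_] := xP Dx; first by move=> /cx[].
have [fnx dec _ _] := fP; have [_] := dec d a da; apply.
have g0 := good 0 (le_elts_trans e0 d0d).
have g1 := good 1 (le_elts_trans e1 d0d).
apply: sub_finite_set (almost_and (inv a) (almost_and g0 (almost_and g1 (good 2 e2)))).
move=> x [Dx nDx] [ix [x0 [x1 x2]]].
have [gx gxx] := ix Dx; have hx : hat a x <> x.
  by rewrite hat_dom //; case: (fnx a) => _; exact.
have : c (hat a x) <> c x by apply: cP; split; rewrite ?gxx //; exact/nesym.
have := c3 x; case E : (c x) => [|[|[|]]] // _; apply.
- exact/x0.
- exact/x1.
exact/x2.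
Qed.

End EventualPullback.

Lemma automorphism_of_bowtie :
  exists phi, automorphism phi /\ ~ trivial_automorphism phi.
Proof.
have [phi phiP] := eventual_pullback; exists phi.
by split; [exact: pullback_automorphism|exact: pullback_nontrivial].
Qed.

End AutomorphismOfBowtie.

(** * Slaloms as lists of candidates *)

Lemma calA_succn : calA succn.
Proof.
split=> // P [N _ NP]; exists N => // n /= Nn; apply: NP => /=.
exact: leqW.
Qed.

(** The last entry of the initial segment of r of length k + 1 is r k. *)
Lemma slalom_candidates (h : nat -> nat) (G : slalom) : calS G -> width G = h ->
  exists L : nat -> seq nat, (forall k, size (L k) = h k) /\
    forall r, captures G r -> forall k, r k \in L k.
Proof.
move=> [h' _ slG] Gh.
exists (fun k => [seq tnth t ord_max | t <- finmap.enum_fset (fset_set (G k))]).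
split=> [k|r Gr k]; first by rewrite size_map -Gh.
have finG : finite_set (G k) by apply: card_le_finite (slG k) _; exact: finite_II.
apply/mapP; exists [tuple r i | i < k.+1]; last by rewrite tnth_mktuple.
by rewrite in_fset_set // inE; exact: Gr.
Qed.

Theorem theorem3p5 :
  exists Phi : set formula, finite_set Phi /\
    forall (V : zset -> Prop) (w1 : zset),
      inner_model Phi V ->
      is_omega1 univ w1 -> is_omega1 V w1 ->
      dagger_LP V w1 ->
      (exists f : elts w1 -> pfun, bowtie f) /\
      (exists phi : PFin -> PFin,
         automorphism phi /\ ~ trivial_automorphism phi).
Proof.
pose Phi := [set succ_graph_formula] `|` [set iter_graph_formula].
have Ps : Phi succ_graph_formula by left.
have Pi : Phi iter_graph_formula by right.
exists Phi; split; first by rewrite finite_setU; split; exact: finite_set1.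
move=> V w1 VM w1P _ dagger.
suff [f fP] : exists f : elts w1 -> pfun, bowtie f.
  by split; [exists f|exact: automorphism_of_bowtie fP].
have [b Vb b_fast] := V_fast VM Ps Pi.
have [|g [gS gw gcap]] := dagger (fun=> succn).
  by move=> _; split; [exact: calA_succn|exact: V_succ VM Ps].
have [L LP] := choice (fun a => slalom_candidates (gS a).1 (gw a)).
apply: (bowtie_exists w1P (L := L)) => [a k|A]; first by have [-> _] := LP a.
have [r rP] := choice (fun k => bits_code (A k) (block_size k)).
have [|a ga] := gcap r.
  exists b => // k; apply: leq_trans (b_fast k); apply: ltnW.
  by case: (rP k).
exists a => k; have [_ /(_ r ga k) rL] := LP a.
by exists (r k) => //; case: (rP k).
Qed.
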